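(* Let $\lambda>0$, $V=(V^x,V^y)\in\mathbb{R}^2$, $\tilde u=(\tilde u^x,\tilde u^y)\in\mathbb{R}^2$ constant, and $(s_q,s_{xy})\in\mathbb{R}^2$ with $s_q\neq 0$, $s_{xy}\neq 0$. Consider the twisted $D_2Q_4$ scheme relative to $\tilde u$ with relaxation parameters $(0,s_q,s_q,s_{xy})$ and equilibrium moments $$m^{eq}(\tilde u)=\rho\,\big(1,\;V^x-\tilde u^x,\;V^y-\tilde u^y,\;\tilde u^x\tilde u^y-\tilde u^xV^y-\tilde u^yV^x\big).$$ Put $\sigma_q=1/s_q-1/2$ and $\sigma_{xy}=1/s_{xy}-1/2$. Then the scheme approaches, at third order in $\Delta t$, the equation $$\partial_t\rho+V\cdot\nabla\rho-\Delta t\,D_2:\nabla^2\rho+\Delta t^2\,D_3:\nabla^3\rho=O(\Delta t^3),$$ where $$D_2=\begin{pmatrix}\sigma_q(\lambda^2-(V^x)^2)&-\sigma_qV^xV^y\\-\sigma_qV^xV^y&\sigma_q(\lambda^2-(V^y)^2)\end{pmatrix},\qquad D_3=\begin{pmatrix}\phi_1(V^x)&\phi_2(\tilde u^x,\tilde u^y,V^x,V^y)\\\phi_2(\tilde u^y,\tilde u^x,V^y,V^x)&\phi_1(V^y)\end{pmatrix},$$ $$\phi_1(V^x)=\frac{V^x}{6}(\lambda^2-(V^x)^2)(1-12\sigma_q^2),$$ $$\phi_2(\tilde u^x,\tilde u^y,V^x,V^y)=\frac12\Big(-V^x(V^y)^2+4\sigma_q^2\big(\lambda^2(\tilde u^x-V^x)+3V^x(V^y)^2-\tilde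 u^yV^xV^y-\tilde u^x(V^y)^2\big)-4\sigma_q\sigma_{xy}\big(\lambda^2(\tilde u^x-V^x)-(V^x\tilde u^yV^y+\tilde u^x(V^y)^2)\big)\Big),$$ $$\nabla^2\rho=\begin{pmatrix}\partial_{xx}\rho&\partial_{xy}\rho\\\partial_{xy}\rho&\partial_{yy}\rho\end{pmatrix},\qquad \nabla^3\rho=\begin{pmatrix}\partial_{xxx}\rho&\partial_{xyy}\rho\\\partial_{xxy}\rho&\partial_{yyy}\rho\end{pmatrix},$$ and $:$ is the entrywise scalar product of $2\times2$ matrices (viewed as vectors of $\mathbb{R}^4$).
   Context: Twisted $D_2Q_4$ scheme. Let $\Delta x,\Delta t>0$ with $\lambda=\Delta x/\Delta t$ fixed. Velocities: $v_0=(\lambda,\lambda)$, $v_1=(-\lambda,\lambda)$, $v_2=(-\lambda,-\lambda)$, $v_3=(\lambda,-\lambda)$. Moment polynomials: $P_0=1$, $P_1=X$, $P_2=Y$, $P_3=XY$. For $\tilde u\in\mathbb{R}^2$, $M(\tilde u)$ is the invertible $4\times4$ matrix $M(\tilde u)_{kj}=P_k(v_j-\tilde u)$. For a distribution vector $f=(f_0,\dots,f_3)$ put $\rho=\sum_j f_j$ and $m=M(\tilde u)f$. One time step with relaxation parameters $(s_0,\dots,s_3)$ is: relaxation $m_k^*=m_k+s_k(m_k^{eq}-m_k)$, where $m^{eq}$ is a given linear function of $\rho$; $f^*=M(\tilde u)^{-1}m^*$; transport $f_j(x,t+\Delta t)=f_j^*(x-v_j\Delta t,t)$. Meaning of ''approaches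 at third order'' (equivalent equation, linear case). The relaxation is linear: $f^*=Rf$ with a constant matrix $R$. On plane waves $f(x,t)=e^{ik\cdot x}\hat f(t)$, $k\in\mathbb{R}^2$, a time step multiplies $\hat f$ by $L(k,\Delta t)=\mathrm{diag}(e^{-i\Delta t\,k\cdot v_j})R$. Since $s_q,s_{xy}\ne0$, $1$ is a simple eigenvalue of $R=L(k,0)$, so for small $\Delta t$ there is a unique eigenvalue $g(k,\Delta t)$ of $L(k,\Delta t)$ close to $1$. The scheme approaches a linear constant coefficient equation up to $O(\Delta t^3)$ if, for each fixed $k$, replacing $\partial_t$ by $\frac1{\Delta t}\log g(k,\Delta t)$ and $\nabla$ by $ik$ in its left-hand side gives a quantity which is $O(\Delta t^3)$ as $\Delta t\to0$ with $\lambda$ fixed. *)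

(* Defs.v *)
From HB Require Import structures.
From mathcomp Require Import all_boot all_order all_algebra.
From mathcomp Require Import all_classical all_reals all_analysis.
From mathcomp Require Import complex ring.

Set Implicit Arguments.
Unset Strict Implicit.
Unset Printing Implicit Defensive.

Import Order.TTheory GRing.Theory Num.Theory.
Import numFieldNormedType.Exports.

Local Open Scope classical_set_scope.
Local Open Scope ring_scope.
Local Open Scope complex_scope.

Section Vectors.

Definition vec2 (T : Type) (a b : T) : 'rV[T]_2 :=
  \row_i if i == 0 then a else b.

Definition mx2 (T : Type) (a b c d : T) : 'M[T]_2 :=
  \matrix_(i, j) if i == 0 then (if j == 0 then a else b)
                 else (if j == 0 then c else d).

Definition vec4 (T : nmodType) (a b c d : T) : 'cV[T]_4 :=
  \col_i [:: a; b; c; d]`_i.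

Definition dotv (T : pzSemiRingType) n (v w : 'rV[T]_n) : T :=
  \sum_i v 0 i * w 0 i.

Definition ddot (T : pzSemiRingType) m n (A B : 'M[T]_(m, n)) : T :=
  \sum_i \sum_j A i j * B i j.

End Vectors.

Section ComplexFunctions.
Context {R : realType}.

Definition cmod (z : R[i]) : R := ComplexField.Normc.normc z.

Definition cis (t : R) : R[i] := cos t +i* sin t.

(* Principal argument, in ]-pi, pi] when z != 0. *)
Definition carg (z : R[i]) : R :=
  let a := acos (complex.Re z / cmod z) in
  if 0 <= complex.Im z then a else - a.

Definition clog (z : R[i]) : R[i] := ln (cmod z) +i* carg z.

End ComplexFunctions.

Section Scheme.
Context {R : realType}.

Definition velocity (lam : R) (j : 'I_4) : 'rV[R]_2 :=
  [:: vec2 lam lam; vec2 (- lam) lam; vec2 (- lam) (- lam);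
      vec2 lam (- lam)]`_j.

Definition moment_poly (k : 'I_4) (w : 'rV[R]_2) : R :=
  [:: 1; w 0 0; w 0 1; w 0 0 * w 0 1]`_k.

Definition moment_mx (lam : R) (u : 'rV[R]_2) : 'M[R]_4 :=
  \matrix_(k, j) moment_poly k (velocity lam j - u).

Definition density (f : 'cV[R]_4) : R := \sum_j f j 0.

(* The equilibrium moments are density f *: e. *)
Definition relax (M : 'M[R]_4) (s e : 'cV[R]_4) (f : 'cV[R]_4) : 'cV[R]_4 :=
  let m := M *m f in
  let meq := density f *: e in
  invmx M *m \col_k (m k 0 + s k 0 * (meq k 0 - m k 0)).

Definition step (v : 'I_4 -> 'rV[R]_2) (M : 'M[R]_4) (s e : 'cV[R]_4) (dt : R)
    (f : 'rV[R]_2 -> 'cV[R]_4) (x : 'rV[R]_2) : 'cV[R]_4 :=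
  \col_j relax M s e (f (x - dt *: v j)) j 0.

Definition relax_mx (M : 'M[R]_4) (s e : 'cV[R]_4) : 'M[R]_4 :=
  \matrix_(i, j) relax M s e (delta_mx j 0) i 0.

Definition amplification_mx (v : 'I_4 -> 'rV[R]_2) (M : 'M[R]_4)
    (s e : 'cV[R]_4) (k : 'rV[R]_2) (dt : R) : 'M[R[i]]_4 :=
  diag_mx (\row_j cis (- (dt * dotv k (v j))))
    *m map_mx (fun x : R => x%:C) (relax_mx M s e).

Lemma relax_mxP M s e f : relax M s e f = relax_mx M s e *m f.
Proof.
pose T : 'M[R]_4 :=
  \matrix_(k, j) (M k j + s k 0 * (e k 0 - M k j)).
have relaxE g : relax M s e g = invmx M *m (T *m g).
  rewrite /relax; congr (_ *m _); apply/colP => k; rewrite !mxE.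
  rewrite /density mulr_suml -sumrB mulr_sumr -big_split /=.
  by apply: eq_bigr => j _; rewrite !mxE mulrDl -mulrA mulrBl [e k 0 * _]mulrC.
have -> : relax_mx M s e = invmx M *m T.
  apply/matrixP => i j; rewrite mxE relaxE mulmxA -colE mxE.
  by [].
by rewrite relaxE mulmxA.
Qed.

Lemma cisD (a b : R) : cis (a + b) = cis a * cis b.
Proof.
rewrite /cis cosD sinD; apply/eqP; rewrite eq_complex /= eqxx /=.
by rewrite addrC.
Qed.

(* On real plane waves one time step acts through amplification_mx. *)
Lemma step_plane_wave v M s e (k : 'rV[R]_2) dt (c : 'cV[R[i]]_4) x :
  step v M s e dt (fun y => \col_j complex.Re (cis (dotv k y) * c j 0)) x =
  \col_j complex.Re (cis (dotv k x) * (amplification_mx v M s e k dt *m c) j 0).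
Proof.
apply/colP => j; rewrite [LHS]mxE [RHS]mxE relax_mxP.
rewrite /amplification_mx -mulmxA mul_diag_mx; move: (relax_mx M s e) => A.
have kxE : dotv k (x - dt *: v j) = dotv k x - dt * dotv k (v j).
  rewrite /dotv mulr_sumr -sumrB; apply: eq_bigr => i _.
  by rewrite !mxE mulrBr mulrCA.
rewrite !mxE mulrA -cisD -kxE mulr_sumr.
rewrite (big_morph _ (raddfD (@complex.Re R)) (raddf0 (@complex.Re R))).
apply: eq_bigr => i _; rewrite !mxE.
by case: (cis _) (c i 0) => [a b] [p q] /=; ring.
Qed.

End Scheme.

Section EquivalentEquation.
Context {R : realType}.

(* g is the eigenvalue of L(k, dt) close to 1, for all small dt > 0. *)
Definition near1_eigenvalue (L : R -> 'M[R[i]]_4) (g : R -> R[i]) : Prop :=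
  cmod (g dt - 1) @[dt --> 0^'+] --> (0 : R) /\
  exists2 r : R, 0 < r &
    \forall dt \near 0^'+,
      eigenvalue (L dt) (g dt) /\
      forall z, eigenvalue (L dt) z -> cmod (z - 1) < r -> z = g dt.

(* An equation is given by the symbol E dt tau xi of its left-hand side:
   tau stands for the time derivative and xi for the gradient. *)
Definition approaches_up_to (n : nat)
    (v : 'I_4 -> 'rV[R]_2) (M : 'M[R]_4) (s e : 'cV[R]_4)
    (E : R -> R[i] -> 'rV[R[i]]_2 -> R[i]) : Prop :=
  forall k : 'rV[R]_2, exists2 g : R -> R[i],
    near1_eigenvalue (amplification_mx v M s e k) g &
    (fun dt => cmod (E dt (clog (g dt) / dt%:C) (\row_i (0 +i* k 0 i))))
      =O_ (0^'+) (fun dt => dt ^+ n).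

Definition grad2 (xi : 'rV[R[i]]_2) : 'M[R[i]]_2 :=
  let x := xi 0 0 in let y := xi 0 1 in
  mx2 (x * x) (x * y) (x * y) (y * y).

Definition grad3 (xi : 'rV[R[i]]_2) : 'M[R[i]]_2 :=
  let x := xi 0 0 in let y := xi 0 1 in
  mx2 (x * x * x) (x * y * y) (x * x * y) (y * y * y).

Definition equation_symbol (V : 'rV[R]_2) (D2 D3 : 'M[R]_2)
    (dt : R) (tau : R[i]) (xi : 'rV[R[i]]_2) : R[i] :=
  tau + dotv (map_mx (fun x : R => x%:C) V) xi
  - dt%:C * ddot (map_mx (fun x : R => x%:C) D2) (grad2 xi)
  + dt%:C ^+ 2 * ddot (map_mx (fun x : R => x%:C) D3) (grad3 xi).

Definition phi1 (lam sigq Vx : R) : R :=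
  Vx / 6 * (lam ^+ 2 - Vx ^+ 2) * (1 - 12 * sigq ^+ 2).

Definition phi2 (lam sigq sigxy ux uy Vx Vy : R) : R :=
  2^-1 * (- (Vx * Vy ^+ 2)
    + 4 * sigq ^+ 2 * (lam ^+ 2 * (ux - Vx) + 3 * Vx * Vy ^+ 2
                       - uy * Vx * Vy - ux * Vy ^+ 2)
    - 4 * sigq * sigxy * (lam ^+ 2 * (ux - Vx)
                          - (Vx * uy * Vy + ux * Vy ^+ 2))).

End EquivalentEquation.

(* Main.v *)
Require Import Defs.
From mathcomp Require Import all_boot all_order all_algebra.
From mathcomp Require Import all_classical all_reals all_analysis.
From mathcomp Require Import complex ring lra.
Import Order.TTheory GRing.Theory Num.Theory.
Import numFieldNormedType.Exports.
Set Implicit Arguments.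
Unset Strict Implicit.
Unset Printing Implicit Defensive.
Local Open Scope classical_set_scope.
Local Open Scope ring_scope.
Local Arguments cmod : simpl never.

(** The idea is to exhibit an approximate eigenpair of the amplification matrix
    L(h), h being the time step, and to use that 1 is a simple eigenvalue of
    L(0) to turn it into a genuine one.

    Write a1 + h a2 + h^2 a3 for what the equation prescribes for the time
    derivative on the wave vector k: the expected eigenvalue is z0 = exp (l h)
    with l h = h a1 + h^2 a2 + h^3 a3.  In the moments 1, X, Y, XY of the
    velocities, transport is exp (- h B), where B is multiplication by
    i (k1 X + k2 Y) modulo X^2 = Y^2 = lam^2, and relaxation is a constant lower
    triangular matrix T with diagonal 1, 1 - sq, 1 - sq, 1 - sxy.  Expanding
    exp (- h B) T m = z0 m for m = m0 + h m1 + h^2 m2 + h^3 m3, the order n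
    reads (T - 1) m_n = d_n with d_n built from m_0, ..., m_(n-1).  As T - 1 maps
    the vectors of zero mass bijectively onto themselves and has no mass in its
    image, m_n exists exactly when the mass of d_n vanishes; for n = 1, 2, 3 these
    are the scalar identities that determine V, D2 and D3 ([defect1_mass], [defect2_mass],
    [defect3_mass]).  Hence (L(h) - z0) w = O(h^4) for a vector w whose entries
    add up to 1 ([approx_eigenvector]).

    Multiplying by the adjugate gives det (L(h) - z0) = O(h^4)
    ([det_of_approx_eigenvector]).  The characteristic polynomial p of L(h)
    depends continuously on h and p'(1) <> 0 at h = 0.  Since p'/p at z0
    is the sum of 1 / (z0 - a) over the roots a, some root lies within
    size p * |p(z0) / p'(z0)| = O(h^4) of z0; and two distinct roots close to 1
    would make a difference quotient of p vanish although it is close to p'(1)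
    ([simple_eigenvalue_perturbation]).  This root is g.

    Finally log g = l h + O(h^4), because the exponential has a Lipschitz inverse near 1
    ([bigOh_clog]), and dividing by h gives the claim. *)

(** * The complex modulus *)

Section Modulus.
Local Open Scope complex_scope.
Context {R : realType}.
Implicit Types (z w : R[i]) (a : R).

Lemma cmod_ge0 z : 0 <= cmod z.
Proof. by case: z => a b; rewrite /cmod /= sqrtr_ge0. Qed.

Lemma cmod0 : cmod (0 : R[i]) = 0.
Proof. exact: ComplexField.Normc.normc0. Qed.

Lemma cmod1 : cmod (1 : R[i]) = 1.
Proof. exact: ComplexField.Normc.normc1. Qed.

Lemma cmodM z w : cmod (z * w) = cmod z * cmod w.
Proof. exact: ComplexField.Normc.normcM. Qed.

Lemma cmodV z : cmod z^-1 = (cmod z)^-1.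
Proof. exact: ComplexField.Normc.normcV. Qed.

Lemma cmod_eq0 z : (cmod z == 0) = (z == 0).
Proof.
apply/eqP/eqP => [|->]; first exact: ComplexField.Normc.eq0_normc.
exact: cmod0.
Qed.

Lemma cmodN z : cmod (- z) = cmod z.
Proof. by rewrite -mulN1r cmodM /cmod /= oppr0 expr0n addr0 sqrrN expr1n sqrtr1 mul1r. Qed.

Lemma cmodD z w : cmod (z + w) <= cmod z + cmod w.
Proof. exact: le_normcD. Qed.

Lemma cmodB z w : cmod (z - w) <= cmod z + cmod w.
Proof. by rewrite -(cmodN w) cmodD. Qed.

Lemma cmod_distC z w : cmod (z - w) = cmod (w - z).
Proof. by rewrite -opprB cmodN. Qed.

Lemma cmod_real a : cmod a%:C = `|a|.
Proof. by rewrite /cmod /= expr0n addr0 sqrtr_sqr. Qed.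

Lemma cmod_le_ReIm z : cmod z <= `|complex.Re z| + `|complex.Im z|.
Proof.
case: z => a b; have {1}-> : a +i* b = a%:C + (0 +i* b) by simpc.
apply: (le_trans (cmodD _ _)); rewrite cmod_real lerD2l.
by rewrite /cmod /= expr0n add0r sqrtr_sqr.
Qed.

Lemma Re_le_cmod z : `|complex.Re z| <= cmod z.
Proof.
case: z => a b; rewrite /cmod /= -[`|a|]sqrtr_sqr ler_wsqrtr //.
by rewrite lerDl sqr_ge0.
Qed.

Lemma Im_le_cmod z : `|complex.Im z| <= cmod z.
Proof.
case: z => a b; rewrite /cmod /= -[`|b|]sqrtr_sqr ler_wsqrtr //.
by rewrite lerDr sqr_ge0.
Qed.

End Modulus.

(** * Orders of vanishing at 0+ *)

Section BigOh.
Local Open Scope complex_scope.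
Context {R : realType}.
Implicit Types (f g : R -> R[i]) (m n : nat).

(** The Landau class O(h^n) at 0+, spelled out for complex functions of a real
    step so that it is closed under the ring operations without any side
    condition. *)
Definition bigOh n f : Prop :=
  exists2 C : R, 0 <= C & \forall h \near 0^'+, cmod (f h) <= C * h ^+ n.

Lemma near0_le1 : \forall h \near (0 : R)^'+, h <= 1.
Proof. exact: nbhs_right_le. Qed.

Lemma bigOh_ext n f g : f =1 g -> bigOh n f -> bigOh n g.
Proof. by move=> /funext->. Qed.

Lemma bigOh_le m n f : (n <= m)%N -> bigOh m f -> bigOh n f.
Proof.
move=> nm [C C0 Cf]; exists C => //; near=> h.
apply: (@le_trans _ _ (C * h ^+ m)); first by near: h.
apply: ler_wpM2l => //; apply: ler_wiXn2l => //.
by near: h; exact: near0_le1.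
Unshelve. all: by end_near. Qed.

Lemma bigOh0 n : bigOh n (fun=> 0).
Proof.
by exists 0 => //; apply: nearW => h; rewrite cmod0 mul0r.
Qed.

Lemma bigOh_cst (c : R[i]) : bigOh 0 (fun=> c).
Proof.
exists (cmod c); first exact: cmod_ge0.
by apply: nearW => h; rewrite expr0 mulr1.
Qed.

Lemma bigOh_id : bigOh 1 (fun h => h%:C).
Proof.
exists 1 => //; by near=> h; rewrite cmod_real mul1r expr1 ger0_norm // ltW.
Unshelve. all: by end_near. Qed.

Lemma bigOhD n f g : bigOh n f -> bigOh n g -> bigOh n (fun h => f h + g h).
Proof.
move=> [C C0 Cf] [D D0 Dg]; exists (C + D); first exact: addr_ge0.
near=> h; apply: (le_trans (cmodD _ _)); rewrite mulrDl.
by apply: lerD; near: h.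
Unshelve. all: by end_near. Qed.

Lemma bigOhN n f : bigOh n f -> bigOh n (fun h => - f h).
Proof.
by move=> [C C0 Cf]; exists C => //; near=> h; rewrite cmodN; near: h.
Unshelve. all: by end_near. Qed.

Lemma bigOhB n f g : bigOh n f -> bigOh n g -> bigOh n (fun h => f h - g h).
Proof. by move=> f_O g_O; apply: bigOhD => //; apply: bigOhN. Qed.

Lemma bigOhM m n f g :
  bigOh m f -> bigOh n g -> bigOh (m + n) (fun h => f h * g h).
Proof.
move=> [C C0 Cf] [D D0 Dg]; exists (C * D); first exact: mulr_ge0.
near=> h; rewrite cmodM exprD mulrACA.
by apply: ler_pM; rewrite ?cmod_ge0 //; near: h.
Unshelve. all: by end_near. Qed.

Lemma bigOhMl n f g : bigOh 0 f -> bigOh n g -> bigOh n (fun h => f h * g h).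
Proof. exact: bigOhM. Qed.

Lemma bigOhMr n f g : bigOh n f -> bigOh 0 g -> bigOh n (fun h => f h * g h).
Proof. by move=> f_O g_O; rewrite -[n]addn0; apply: bigOhM. Qed.

Lemma bigOhX n f k : bigOh n f -> bigOh (n * k) (fun h => f h ^+ k).
Proof.
move=> f_O; elim: k => [|k IH]; first by rewrite muln0; exact: bigOh_cst.
by rewrite mulnS; under [X in bigOh _ X]funext do rewrite exprS; exact: bigOhM.
Qed.

Lemma bigOh_Xid n : bigOh n (fun h => h%:C ^+ n).
Proof. by rewrite -{1}[n]mul1n; apply: bigOhX; exact: bigOh_id. Qed.

Lemma bigOh_sum n (I : Type) (r : seq I) (P : pred I) (F : I -> R -> R[i]) :
  (forall i, bigOh n (F i)) -> bigOh n (fun h => \sum_(i <- r | P i) F i h).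
Proof.
move=> F_O; elim: r => [|i r IH].
  by under [X in bigOh _ X]funext do rewrite big_nil; exact: bigOh0.
under [X in bigOh _ X]funext do rewrite big_cons.
by case: (P i) => //; exact: bigOhD.
Qed.

Lemma bigOh0_prod (I : Type) (r : seq I) (P : pred I) (F : I -> R -> R[i]) :
  (forall i, bigOh 0 (F i)) -> bigOh 0 (fun h => \prod_(i <- r | P i) F i h).
Proof.
move=> F_O; elim: r => [|i r IH].
  by under [X in bigOh _ X]funext do rewrite big_nil; exact: bigOh_cst.
under [X in bigOh _ X]funext do rewrite big_cons.
by case: (P i) => //; exact: bigOhMl.
Qed.

Lemma bigOh0_det n (A : R -> 'M[R[i]]_n) :
  (forall i j, bigOh 0 (fun h => A h i j)) -> bigOh 0 (fun h => \det (A h)).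
Proof.
move=> A_O; apply: bigOh_sum => s; apply: bigOhMl; first exact: bigOh_cst.
by apply: bigOh0_prod => i; exact: A_O.
Qed.

Lemma bigOh_small f (e : R) : bigOh 1 f -> 0 < e ->
  \forall h \near 0^'+, cmod (f h) < e.
Proof.
move=> [C C0 Cf] e0; near=> h.
have hp : 0 < h by [].
apply: (@le_lt_trans _ _ (C * h ^+ 1)); first by near: h.
rewrite expr1; apply: (@le_lt_trans _ _ ((C + 1) * h)).
  by rewrite ler_wpM2r ?ltW // ltrDl.
rewrite mulrC -ltr_pdivlMr ?ltr_wpDl //.
by near: h; apply: nbhs_right_lt; rewrite divr_gt0 ?ltr_wpDl.
Unshelve. all: by end_near. Qed.

Lemma bigOh_cmod_cvg0 f : bigOh 1 f -> cmod (f h) @[h --> 0^'+] --> (0 : R).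
Proof.
move=> f_O; apply/cvgrPdist_lt => e e0; near=> h.
rewrite sub0r normrN ger0_norm ?cmod_ge0 //.
by near: h; exact: bigOh_small.
Unshelve. all: by end_near. Qed.

End BigOh.

(** * Third order Taylor bounds for exp, cos and sin *)

Section RealTaylor.
Context {R : realType}.
Implicit Types (x y C : R) (n : nat).

(** Mean value theorem.  The constant is not divided by n.+1, which is enough to
    climb one order at a time in the Taylor estimates below. *)
Lemma bound_from_derivative (f df : R -> R) C n :
    (forall x, is_derive x 1 f (df x)) -> f 0 = 0 ->
    (forall x, `|x| <= 1 -> `|df x| <= C * `|x| ^+ n) ->
  forall x, `|x| <= 1 -> `|f x| <= C * `|x| ^+ n.+1.
Proof.
move=> f_df f0 df_le x x1.
have f_cont : continuous f.
  by move=> y; apply: differentiable_continuous; apply/derivable1_diffP; case: (f_df y).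
have [c cx fxE] : exists2 c, `|c| <= `|x| & f x = df c * x.
  have [x0|/ltW x0] := leP 0 x.
    have [c] := @MVT_segment R f df 0 x x0 (fun y _ => f_df y)
      (continuous_subspaceT f_cont).
    rewrite in_itv /= f0 !subr0 => /andP[c0 cx] fx.
    by exists c; rewrite ?ger0_norm.
  have [c] := @MVT_segment R f df x 0 x0 (fun y _ => f_df y)
    (continuous_subspaceT f_cont).
  rewrite in_itv /= f0 !sub0r => /andP[cx c0] fx.
  exists c; first by rewrite !ler0_norm // lerN2.
  by apply: oppr_inj; rewrite fx mulrN.
rewrite fxE normrM exprSr mulrA ler_wpM2r //.
apply: le_trans (df_le c (le_trans cx x1)) _.
(* If C < 0 the bound on df is already contradictory at 1. *)
have [C0|C0] := leP 0 C; first by rewrite ler_wpM2l // lerXn2r ?nnegrE.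
have dc_le := df_le 1; rewrite normr1 lexx expr1n mulr1 in dc_le.
by have := le_lt_trans (le_trans (normr_ge0 _) (dc_le isT)) C0; rewrite ltxx.
Qed.

Lemma expR_taylor3 : exists C, forall x, `|x| <= 1 ->
  `|expR x - (1 + x + x ^+ 2 / 2 + x ^+ 3 / 6)| <= C * `|x| ^+ 4.
Proof.
exists (expR 1).
apply: (bound_from_derivative (df := fun x => expR x - (1 + x + x ^+ 2 / 2))).
- by move=> x; apply: is_derive_eq; rewrite /GRing.scale /=; field.
- by rewrite expR0; ring.
apply: (bound_from_derivative (df := fun x => expR x - (1 + x))).
- by move=> x; apply: is_derive_eq; rewrite /GRing.scale /=; field.
- by rewrite expR0; ring.
apply: (bound_from_derivative (df := fun x => expR x - 1)).
- by move=> x; apply: is_derive_eq; rewrite /GRing.scale /=; field.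
- by rewrite expR0; ring.
apply: (bound_from_derivative (df := fun x => expR x)).
- by move=> x; apply: is_derive_eq; rewrite /GRing.scale /=; field.
- by rewrite expR0; ring.
move=> x x1; rewrite expr0 mulr1 ger0_norm ?expR_ge0 // ler_expR.
by rewrite (le_trans (ler_norm x)).
Qed.

Lemma cos_sin_taylor3 x : `|x| <= 1 ->
  `|cos x - (1 - x ^+ 2 / 2)| <= `|x| ^+ 4 /\
  `|sin x - (x - x ^+ 3 / 6)| <= `|x| ^+ 4.
Proof.
have sin1 y : `|y| <= 1 -> `|sin y| <= 1 * `|y| ^+ 1.
  move: y; apply: (bound_from_derivative (df := cos)) => [|y _].
  - exact: sin0.
  - by rewrite expr0 mulr1 cos_max.
have cos1 y : `|y| <= 1 -> `|cos y - 1| <= 1 * `|y| ^+ 2.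
  move: y; apply: (bound_from_derivative (df := fun y => - sin y)) => [y||y y1].
  - by apply: is_derive_eq; rewrite /GRing.scale /=; ring.
  - by rewrite cos0 subrr.
  - by rewrite normrN; exact: sin1.
have sin3 y : `|y| <= 1 -> `|sin y - y| <= 1 * `|y| ^+ 3.
  move: y; apply: (bound_from_derivative (df := fun y => cos y - 1)) => [|//].
  by rewrite sin0 subrr.
have cos4 y : `|y| <= 1 -> `|cos y - (1 - y ^+ 2 / 2)| <= 1 * `|y| ^+ 4.
  move: y; apply: (bound_from_derivative (df := fun y => - (sin y - y))) => [y||y y1].
  - by apply: is_derive_eq; rewrite /GRing.scale /=; field.
  - by rewrite cos0; ring.
  - by rewrite normrN; exact: sin3.
have sin4 y : `|y| <= 1 -> `|sin y - (y - y ^+ 3 / 6)| <= 1 * `|y| ^+ 5.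
  move: y; apply: (bound_from_derivative
      (df := fun y => cos y - (1 - y ^+ 2 / 2))) => [y||//].
  - by apply: is_derive_eq; rewrite /GRing.scale /=; field.
  - by rewrite sin0; ring.
move=> x1; split; first by rewrite -[leRHS]mul1r; exact: cos4.
apply: (le_trans (sin4 _ x1)); rewrite mul1r.
exact: ler_wiXn2l.
Qed.

End RealTaylor.

(** * Complex exponential and logarithm near 1 *)

Section ComplexExponential.
Local Open Scope complex_scope.
Context {R : realType}.
Implicit Types (z w : R[i]) (f g l : R -> R[i]).

Definition cexp z : R[i] := (expR (complex.Re z))%:C * cis (complex.Im z).

Lemma cexpD z w : cexp (z + w) = cexp z * cexp w.
Proof.
by rewrite /cexp !raddfD /= expRD cisD rmorphM /= mulrACA.
Qed.

Lemma cexp0 : cexp (0 : R[i]) = 1.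
Proof. by rewrite /cexp /cis /= expR0 cos0 sin0 mul1r. Qed.

Lemma cexp_neq0 z : cexp z != 0.
Proof.
apply/eqP => z0; have := cexpD z (- z).
by rewrite subrr cexp0 z0 mul0r => /eqP; rewrite oner_eq0.
Qed.

Lemma cmod_cis (t : R) : cmod (cis t) = 1.
Proof. by rewrite /cmod /= cos2Dsin2 sqrtr1. Qed.

Lemma cmod_cexp z : cmod (cexp z) = expR (complex.Re z).
Proof. by rewrite cmodM cmod_cis mulr1 cmod_real ger0_norm ?expR_ge0. Qed.

Lemma cisE (t : R) : cis t = cexp (0 +i* t).
Proof. by rewrite /cexp /= expR0 mul1r. Qed.

Lemma bigOh_Re n f : bigOh n f -> bigOh n (fun h => (complex.Re (f h))%:C).
Proof.
move=> [C C0 Cf]; exists C => //; near=> h; rewrite cmod_real.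
by apply: (le_trans (Re_le_cmod _)); near: h.
Unshelve. all: by end_near. Qed.

Lemma bigOh_Im n f : bigOh n f -> bigOh n (fun h => (complex.Im (f h))%:C).
Proof.
move=> [C C0 Cf]; exists C => //; near=> h; rewrite cmod_real.
by apply: (le_trans (Im_le_cmod _)); near: h.
Unshelve. all: by end_near. Qed.

(** Transfers a real Taylor remainder to the real part of a small function; the
    imaginary part y is reached by taking f to be y%:C. *)
Lemma bigOh_real_remainder n (phi : R -> R) f :
    (exists C, forall x, `|x| <= 1 -> `|phi x| <= C * `|x| ^+ n) ->
    bigOh 1 f ->
  bigOh n (fun h => (phi (complex.Re (f h)))%:C).
Proof.
move=> [C phi_le] f_O; have [D D0 Df] := f_O.
have C0 : 0 <= C.
  by have := phi_le 1; rewrite normr1 expr1n mulr1 => /(_ (lexx _)); apply: le_trans.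
exists (C * D ^+ n); first by rewrite mulr_ge0 ?exprn_ge0.
near=> h; rewrite cmod_real.
apply: le_trans (phi_le _ _) _.
  apply: (le_trans (Re_le_cmod _)); apply: ltW; near: h.
  exact: bigOh_small.
rewrite -mulrA -exprMn ler_wpM2l // lerXn2r ?nnegrE ?mulr_ge0 //.
apply: (le_trans (Re_le_cmod _)); rewrite -{2}[h]expr1; near: h.
exact: Df.
Unshelve. all: by end_near. Qed.

Definition exp_taylor3 z : R[i] := 1 + z + z ^+ 2 / 2 + z ^+ 3 / 6.

(** The product of the Taylor polynomials of expR and cis exceeds that of cexp by an
    explicit sum of monomials of degree at least 4. *)
Lemma cexp_taylor3 f : bigOh 1 f ->
  bigOh 4 (fun h => cexp (f h) - exp_taylor3 (f h)).
Proof.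
move=> f_O; have x_O := bigOh_Re f_O; have y_O := bigOh_Im f_O.
have [C exp_le] := @expR_taylor3 R.
have E_O := bigOh_real_remainder (ex_intro _ C exp_le) x_O.
have cos_le : exists C, forall x : R, `|x| <= 1 ->
    `|cos x - (1 - x ^+ 2 / 2)| <= C * `|x| ^+ 4.
  by exists 1 => x x1; rewrite mul1r; case: (cos_sin_taylor3 x1).
have sin_le : exists C, forall x : R, `|x| <= 1 ->
    `|sin x - (x - x ^+ 3 / 6)| <= C * `|x| ^+ 4.
  by exists 1 => x x1; rewrite mul1r; case: (cos_sin_taylor3 x1).
have c_O := bigOh_real_remainder cos_le y_O; have s_O := bigOh_real_remainder sin_le y_O.
move: E_O c_O s_O => /=; move: x_O y_O.
set x := fun h => (complex.Re (f h))%:C; set y := fun h => (complex.Im (f h))%:C.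
move=> x_O y_O.
set E := fun h => (expR _ - _)%:C; set c := fun h => (cos _ - _)%:C.
set s := fun h => (sin _ - _)%:C => E_O c_O s_O.
pose w h := 'i%C * y h.
have w_O : bigOh 1 w by apply: bigOhMl y_O; exact: bigOh_cst.
have cis_O : bigOh 0 (fun h => cis (complex.Im (f h))).
  by exists 1 => //; apply: nearW => h; rewrite cmod_cis expr0 mulr1.
(* With f = x + w, w = i y, all the leftover terms are monomials in x and w. *)
have mon (m n : nat) (k : R[i]) : (4 <= m + n)%N ->
    bigOh 4 (fun h => k * (x h ^+ m * w h ^+ n)).
  move=> mn; apply: bigOhMl; first exact: bigOh_cst.
  apply: (bigOh_le mn); apply: bigOhM.
    by rewrite -{1}[m]mul1n; exact: bigOhX.
  by rewrite -{1}[n]mul1n; exact: bigOhX.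
have Te_O : bigOh 0 (fun h => exp_taylor3 (x h)).
  have x0 : bigOh 0 x by exact: bigOh_le x_O.
  have xn n : bigOh 0 (fun h => x h ^+ n) by rewrite -{1}[0%N](mul0n n); exact: bigOhX.
  apply: bigOhD; last by apply: bigOhMr; [exact: xn|exact: bigOh_cst].
  apply: bigOhD; last by apply: bigOhMr; [exact: xn|exact: bigOh_cst].
  by apply: bigOhD => //; exact: bigOh_cst.
have i2 : 'i%C ^+ 2 = -1 :> R[i] by exact: sqr_i.
apply: (@bigOh_ext _ _ (fun h =>
  E h * cis (complex.Im (f h)) + exp_taylor3 (x h) * (c h + 'i%C * s h) +
  (6^-1 * (x h ^+ 1 * w h ^+ 3) + 4^-1 * (x h ^+ 2 * w h ^+ 2)
   + 6^-1 * (x h ^+ 3 * w h ^+ 1) + 12^-1 * (x h ^+ 2 * w h ^+ 3)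
   + 12^-1 * (x h ^+ 3 * w h ^+ 2) + 36^-1 * (x h ^+ 3 * w h ^+ 3)))); last first.
  apply: bigOhD; last by do ![apply: bigOhD | exact: mon].
  apply: bigOhD; first exact: bigOhMr.
  apply: bigOhMl => //; apply: bigOhD => //.
  by apply: bigOhMl => //; exact: bigOh_cst.
move=> h.
have fE : f h = x h + w h.
  by rewrite /x /w /y; case: (f h) => a b; simpc.
have cisE' : cis (complex.Im (f h)) =
    c h + 'i%C * s h + (1 + w h + w h ^+ 2 / 2 + w h ^+ 3 / 6).
  have -> : cis (complex.Im (f h)) =
      (cos (complex.Im (f h)))%:C + 'i%C * (sin (complex.Im (f h)))%:C.
    by rewrite /cis; simpc.
  have -> : w h ^+ 2 = - y h ^+ 2 by rewrite exprMn i2 mulN1r.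
  have -> : w h ^+ 3 = - ('i%C * y h ^+ 3).
    by rewrite exprMn exprS i2 mulrN1 mulNr.
  rewrite /c /s /w /y !(rmorphB, rmorphD, rmorphM, rmorphXn, fmorphV, rmorph_nat) /=.
  by rewrite rmorph1; ring.
have -> : cexp (f h) = (E h + exp_taylor3 (x h)) * cis (complex.Im (f h)).
  congr (_ * _); rewrite /E /exp_taylor3 /x.
  rewrite !(rmorphB, rmorphD, rmorphM, rmorphXn, fmorphV, rmorph_nat) /=.
  by rewrite rmorph1; ring.
by rewrite cisE' fE /exp_taylor3; field.
Qed.

Lemma bigOh_cexp_sub1 f : bigOh 1 f -> bigOh 1 (fun h => cexp (f h) - 1).
Proof.
move=> f_O.
have f_X n : bigOh 1 (fun h => f h ^+ n.+1).
  by apply: (@bigOh_le _ (1 * n.+1)); [rewrite mul1n|exact: bigOhX].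
apply: (@bigOh_ext _ _ (fun h => (cexp (f h) - exp_taylor3 (f h)) +
  (f h + f h ^+ 2 / 2 + f h ^+ 3 / 6))) => [h|]; first by rewrite /exp_taylor3; ring.
apply: bigOhD; first by apply: bigOh_le (cexp_taylor3 f_O).
apply: bigOhD; last by apply: bigOhMr => //; exact: bigOh_cst.
apply: bigOhD => //.
by apply: bigOhMr => //; exact: bigOh_cst.
Qed.

Lemma cexp_clog z : z != 0 -> cexp (clog z) = z.
Proof.
move=> z0; have m0 : 0 < cmod z by rewrite lt_def cmod_eq0 z0 cmod_ge0.
rewrite /cexp /clog /= lnK ?posrE //.
have mE : cmod z ^+ 2 = complex.Re z ^+ 2 + complex.Im z ^+ 2.
  by case: z {z0 m0} => a b; rewrite sqr_sqrtr ?addr_ge0 ?sqr_ge0.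
set r := complex.Re z / cmod z.
have r_range : -1 <= r <= 1.
  by rewrite -ler_norml normf_div (ger0_norm (cmod_ge0 z)) ler_pdivrMr ?mul1r ?Re_le_cmod.
have sinE : sin (acos r) = `|complex.Im z| / cmod z.
  rewrite sin_acos // -[RHS]ger0_norm ?divr_ge0 ?cmod_ge0 // -sqrtr_sqr.
  congr Num.sqrt; rewrite [RHS]expr_div_n real_normK ?num_real //.
  have -> : complex.Im z ^+ 2 = cmod z ^+ 2 - complex.Re z ^+ 2 by rewrite mE; ring.
  by rewrite /r; field; rewrite gt_eqF.
have -> : cis (carg z) = r +i* (complex.Im z / cmod z).
  rewrite /cis /carg -/r; case: leP => [Im0|Im0].
    by rewrite acosK ?in_itv // sinE ger0_norm.
  by rewrite cosN sinN acosK ?in_itv // sinE ler0_norm ?ltW // mulNr opprK.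
rewrite /r; move: m0; generalize (cmod z) => m m0.
by case: (z) => a b /=; simpc; rewrite ![m * _]mulrC !mulfVK ?gt_eqF.
Qed.

(** Lower Lipschitz bound for the exponential at 0.  The modulus of cexp z controls
    the real part, and then the imaginary part of cexp z controls sin y, which is
    at least |y| / 2. *)
Lemma cmod_le_cexp z : `|complex.Re z| <= 1 -> `|complex.Im z| <= 2^-1 ->
  cmod z <= (2 + 2 * expR 1) * cmod (cexp z - 1).
Proof.
case: z => x y /= x1 y2; set d := cmod (cexp _ - 1).
have x_le : `|x| <= 2 * d.
  have ex1 : `|expR x - 1| <= d.
    have e_le : expR x <= d + 1.
      have := cmodD (cexp (x +i* y) - 1) 1.
      by rewrite subrK cmod_cexp cmod1.
    have e_ge : 1 <= d + expR x.
      have := cmodD (1 - cexp (x +i* y)) (cexp (x +i* y)).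
      by rewrite subrK cmod_cexp cmod1 cmod_distC.
    by rewrite ler_norml; apply/andP; split; lra.
  have d0 : 0 <= d by exact: cmod_ge0.
  have [x0|x0] := leP 0 x.
    have := expR_ge1Dx x; rewrite ger0_norm // => ?.
    by move: ex1; rewrite ler_norml => /andP[_ ?]; lra.
  have exN : 1 - x <= expR (- x) by exact: expR_ge1Dx.
  have ee : expR x * expR (- x) = 1 by rewrite -expRD subrr expR0.
  have e0 := expR_gt0 x.
  have : expR x * (1 - x) <= 1 by rewrite -[leRHS]ee ler_wpM2l // ltW.
  move: ex1; rewrite ler_norml ltr0_norm // => /andP[ex1 _] ?.
  move: x1; rewrite ltr0_norm // => x1.
  by nra.
have y_le : `|y| <= 2 * expR 1 * d.
  have sin_le : expR x * `|sin y| <= d.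
    apply: le_trans (Im_le_cmod _); rewrite /cexp /cis /= /d.
    by rewrite !(mul0r, addr0, subr0) normrM ger0_norm ?expR_ge0 //.
  have y1 : `|y| <= 1 by lra.
  have [_ sin_taylor] := cos_sin_taylor3 y1.
  have aux (t u : R) : 0 <= t -> t <= 2^-1 ->
      t <= u + t ^+ 4 + t ^+ 3 / 6 -> t / 2 <= u.
    move=> t0 t2 tu.
    have t22 : t ^+ 2 <= 4^-1 by have := ler_pM t0 t0 t2 t2; rewrite expr2; lra.
    have t3 : t ^+ 3 <= t / 4 by rewrite exprS ler_wpM2l.
    have t4 : t ^+ 4 <= t / 8 by rewrite exprS ler_wpM2l //; lra.
    by lra.
  have sin_ge : `|y| / 2 <= `|sin y|.
    have yE : y = sin y - (sin y - (y - y ^+ 3 / 6)) + y ^+ 3 / 6 by field.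
    have : `|y| <= `|sin y| + `|y| ^+ 4 + `|y| ^+ 3 / 6.
      rewrite {1}yE (le_trans (ler_normD _ _)) // lerD //; last first.
        by rewrite normrM normrX [`|6^-1|]ger0_norm.
      by rewrite (le_trans (ler_normB _ _)) // lerD2l.
    exact: (aux _ _ (normr_ge0 y) y2).
  have : expR 1 * (expR x * `|sin y|) <= expR 1 * d by rewrite ler_wpM2l ?expR_ge0.
  rewrite mulrA -expRD => H.
  have : `|sin y| <= expR (1 + x) * `|sin y|.
    rewrite ler_peMl // -[leLHS]expR0 ler_expR.
    by move: x1; rewrite ler_norml => /andP[]; lra.
  by lra.
apply: (le_trans (cmod_le_ReIm _)) => /=; lra.
Qed.

(** The argument is bounded by comparing cosines, because acos has no derivative
    at 1. *)
Lemma clog_near1 : exists2 r : R, 0 < r & forall z, cmod (z - 1) < r ->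
  [/\ z != 0, `|complex.Re (clog z)| <= 2^-1 & `|complex.Im (clog z)| <= 4^-1].
Proof.
have pi4 : (4^-1 : R) <= pi by have := pi_ge2 R; lra.
have cos4 : cos (4^-1 : R) < 1.
  by rewrite -[ltRHS](cos0 R) ltr_cos ?in_itv /= ?lexx ?pi_ge0
    ?invr_ge0 ?invr_gt0 ?ler0n ?ltr0n ?pi4.
exists (Num.min 4^-1 ((1 - cos 4^-1) / 2)).
  by rewrite lt_min invr_gt0 ltr0n divr_gt0 ?subr_gt0 ?ltr0n.
move=> z; rewrite lt_min => /andP[]; set d := cmod (z - 1) => d4 dcos.
have m_le : cmod z <= 1 + d.
  by rewrite -[z](subrK 1) (le_trans (cmodD _ _)) // cmod1 addrC.
have Re_ge : 1 - d <= complex.Re z.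
  have := Re_le_cmod (1 - z); rewrite cmod_distC -/d ler_norml => /andP[_].
  by case: (z) => a b /=; lra.
have m_ge : 1 - d <= cmod z.
  by rewrite (le_trans Re_ge) // (le_trans (ler_norm _)) // Re_le_cmod.
have d0 : 0 <= d by exact: cmod_ge0.
have m0 : 0 < cmod z by lra.
split; first by rewrite -cmod_eq0 gt_eqF.
  rewrite /clog /= ler_norml; apply/andP; split.
    rewrite lerNl -lnV ?posrE //.
    have -> : (cmod z)^-1 = 1 + ((cmod z)^-1 - 1) by ring.
    apply: (le_trans (le_ln1Dx _)).
      have : 0 < (cmod z)^-1 by rewrite invr_gt0.
      by lra.
    have : (cmod z)^-1 <= (3 / 4)^-1 by rewrite lef_pV2 ?posrE //; lra.
    have -> : (3 / 4)^-1 = 4 / 3 :> R by field.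
    by lra.
  have -> : cmod z = 1 + (cmod z - 1) by ring.
  by apply: (le_trans (le_ln1Dx _)); lra.
suff acos_le : 0 <= acos (complex.Re z / cmod z) <= 4^-1.
  rewrite /clog /= /carg; case: ifP => _; rewrite ?normrN ger0_norm; by case/andP: acos_le.
set r := complex.Re z / cmod z.
have r_range : -1 <= r <= 1.
  by rewrite -ler_norml normf_div (ger0_norm (cmod_ge0 z)) ler_pdivrMr ?mul1r ?Re_le_cmod.
rewrite acos_ge0 //= leNgt; apply/negP => acos_gt.
have := acos_gt; rewrite -ltr_cos ?in_itv /= ?acos_ge0 ?acos_lepi ?invr_ge0 //=; last first.
  by rewrite ler0n /= pi4.
rewrite acosK ?in_itv //; apply/negP; rewrite -leNgt /r.
rewrite ler_pdivlMr //.
(* cos (1/4) <= 1 - 2 d, so that cos (1/4) |z| <= (1 - 2 d) (1 + d) <= 1 - d. *)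
have k_le : cos 4^-1 * cmod z <= (1 - 2 * d) * cmod z.
  by rewrite ler_wpM2r ?cmod_ge0 //; lra.
have m_le' : (1 - 2 * d) * cmod z <= (1 - 2 * d) * (1 + d).
  by rewrite ler_wpM2l //; lra.
by have := mulr_ge0 d0 d0; lra.
Qed.

(** Applied to b = clog f - l, whose exponential is 1 + (f - cexp l) cexp (- l). *)
Lemma bigOh_clog n f l : (0 < n)%N -> bigOh 1 l ->
  bigOh n (fun h => f h - cexp (l h)) -> bigOh n (fun h => clog (f h) - l h).
Proof.
move=> n0 l_O fl_O.
have ecexp_O : bigOh 1 (fun h => cexp (- l h) - 1) by apply/bigOh_cexp_sub1/bigOhN.
have f1_O : bigOh 1 (fun h => f h - 1).
  apply: (@bigOh_ext _ _ (fun h => (f h - cexp (l h)) + (cexp (l h) - 1))).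
    by move=> h; ring.
  by apply: bigOhD; [exact: bigOh_le fl_O|exact: bigOh_cexp_sub1].
have b_O : bigOh n (fun h => (f h - cexp (l h)) * cexp (- l h)).
  apply: bigOhMr => //.
  apply: (@bigOh_ext _ _ (fun h => (cexp (- l h) - 1) + 1)); first by move=> h; ring.
  by apply: bigOhD; [exact: bigOh_le ecexp_O|exact: bigOh_cst].
have [r r0 clog_le] := clog_near1.
have [C C0 b_le] := b_O.
exists ((2 + 2 * expR 1) * C).
  by rewrite mulr_ge0 // addr_ge0 // mulr_ge0 // expR_ge0.
near=> h.
have f1 : cmod (f h - 1) < r by near: h; exact: bigOh_small.
have [f0 ReL ImL] := clog_le _ f1.
have l_lt : cmod (l h) < 4^-1 by near: h; exact: bigOh_small.
have := Re_le_cmod (l h); have := Im_le_cmod (l h) => Iml Rel.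
apply: (le_trans (cmod_le_cexp _ _)).
- rewrite raddfB /= (le_trans (ler_normB _ _)) //; lra.
- rewrite raddfB /= (le_trans (ler_normB _ _)) //; lra.
rewrite -mulrA ler_wpM2l ?addr_ge0 ?mulr_ge0 ?expR_ge0 //.
have -> : cexp (clog (f h) - l h) - 1 = (f h - cexp (l h)) * cexp (- l h).
  by rewrite cexpD cexp_clog // mulrBl -cexpD subrr cexp0.
by near: h.
Unshelve. all: by end_near. Qed.

End ComplexExponential.

(** * Locating a root from an approximate one *)

Section RootLocation.
Local Open Scope complex_scope.
Context {R : realType}.
Local Notation C := R[i].
Implicit Types (p : {poly C}) (a b z : C) (s : seq C) (r : R).

Lemma cmodX z n : cmod (z ^+ n) = cmod z ^+ n.
Proof. by elim: n => [|n IH]; rewrite ?expr0 ?cmod1 // !exprS cmodM IH. Qed.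

Lemma cmod_sum (I : Type) (t : seq I) (P : pred I) (F : I -> C) :
  cmod (\sum_(i <- t | P i) F i) <= \sum_(i <- t | P i) cmod (F i).
Proof.
elim/big_rec2: _ => [|i x y _ le_xy]; first by rewrite cmod0.
by apply: (le_trans (cmodD _ _)); rewrite lerD2l.
Qed.

(** The estimate |p'/p| <= n / r coming from p'/p = sum of 1 / (z - a), in a form
    free of division. *)
Lemma deriv_le_of_roots_away s z r : 0 <= r ->
    (forall a, a \in s -> r <= cmod (z - a)) ->
    let p := \prod_(a <- s) ('X - a%:P) in
  r * cmod p^`().[z] <= (size s)%:R * cmod p.[z].
Proof.
move=> r0; elim: s => [|a s IH] s_away /=.
  by rewrite big_nil derivC horner0 cmod0 mulr0 mul0r.
have {}IH := IH (fun b bs => s_away b (@mem_behead _ (a :: s) b bs)).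
rewrite big_cons; set p := \prod_(b <- s) _ in IH *.
rewrite derivM derivXsubC mul1r !hornerE cmodM.
have a_away : r <= cmod (z - a) by apply: s_away; rewrite mem_head.
apply: (@le_trans _ _ (r * (cmod p.[z] + cmod (z - a) * cmod p^`().[z]))).
  by rewrite ler_wpM2l // (le_trans (cmodD _ _)) // cmodM.
rewrite mulrDr -natr1 mulrDl mul1r addrC lerD //.
  by rewrite mulrCA [leRHS]mulrCA ler_wpM2l ?cmod_ge0.
by rewrite ler_wpM2r ?cmod_ge0.
Qed.

Lemma nearest_in_seq s z : s != [::] ->
  exists2 a, a \in s & forall b, b \in s -> cmod (z - a) <= cmod (z - b).
Proof.
elim: s => // c s IH _; have [->|/IH [a as_ a_min]] := eqVneq s [::].
  by exists c; rewrite ?mem_head // => b; rewrite inE => /eqP->.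
have [le_ac|/ltW le_ca] := leP (cmod (z - a)) (cmod (z - c)).
  exists a; first by rewrite inE as_ orbT.
  by move=> b; rewrite inE => /predU1P[->|/a_min].
exists c; first exact: mem_head.
by move=> b; rewrite inE => /predU1P[->//|/a_min]; apply: le_trans.
Qed.

(** Newton-type localisation of a root: apply the previous bound with r the distance
    to the nearest root. *)
Lemma root_near p z : p \is monic -> (1 < size p)%N ->
  exists2 a, root p a &
    cmod (z - a) * cmod p^`().[z] <= (size p)%:R * cmod p.[z].
Proof.
move=> p_mon p_size; have [s pE] := closed_field_poly_normal p.
rewrite (monicP p_mon) scale1r in pE.
have s_size : size p = (size s).+1 by rewrite pE size_prod_XsubC.
have s_n0 : s != [::] by move: p_size; rewrite s_size; case: (s).
have [a as_ a_min] := nearest_in_seq z s_n0.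
exists a; first by rewrite pE root_prod_XsubC.
rewrite {1 3}pE; apply: le_trans (deriv_le_of_roots_away (cmod_ge0 _) a_min) _.
by rewrite ler_wpM2r ?cmod_ge0 // s_size ler_nat.
Qed.

(** The difference quotient of p as a polynomial in both points; on the diagonal it
    is the derivative, so one estimate serves for existence and uniqueness. *)
Definition secant p a b : C :=
  \sum_(i < size p) p`_i * \sum_(j < i) a ^+ (i.-1 - j) * b ^+ j.

Lemma horner_secant p a b : p.[a] - p.[b] = (a - b) * secant p a b.
Proof.
rewrite !horner_coef -sumrB mulr_sumr; apply: eq_bigr => i _.
by rewrite -mulrBr subrXX mulrCA.
Qed.

Lemma deriv_secant p a : p^`().[a] = secant p a a.
Proof.
rewrite -{1}[p]coefK poly_def raddf_sum horner_sum; apply: eq_bigr => i _.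
rewrite /= derivZ derivXn hornerZ hornerMn hornerXn; congr (_ * _).
rewrite (eq_bigr (fun=> a ^+ i.-1)) ?sumr_const ?card_ord // => j _.
by rewrite -exprD subnK //; case: (nat_of_ord i) j => [[]|k [j]].
Qed.

Lemma secant_near_coef1 p a b r : (1 < size p)%N ->
    cmod a <= r -> cmod b <= r -> r <= 1 ->
  cmod (secant p a b - p`_1) <= r * \sum_(i < size p) i%:R * cmod p`_i.
Proof.
move=> p_size ar br r1; have r0 : 0 <= r by rewrite (le_trans (cmod_ge0 a)).
have -> : p`_1 = \sum_(i < size p) p`_i * (i == 1%N :> nat)%:R.
  rewrite (bigD1 (Ordinal p_size)) //= mulr1 big1 ?addr0 // => i.
  by rewrite -val_eqE /= => /negPf->; rewrite mulr0.
rewrite /secant -sumrB mulr_sumr; apply: le_trans (cmod_sum _ _ _) _.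
apply: ler_sum => i _; rewrite -mulrBr cmodM mulrA [leRHS]mulrC.
rewrite ler_wpM2l ?cmod_ge0 //.
case: (nat_of_ord i) => [|[|k]] /=.
- by rewrite big_ord0 subr0 cmod0 mulr0.
- by rewrite big_ord1 subnn !expr0 mulr1 subrr cmod0 mulr1.
rewrite subr0; apply: le_trans (cmod_sum _ _ _) _.
rewrite [r * _]mulrC mulr_natl -[X in _ *+ X]card_ord -sumr_const.
apply: ler_sum => j _; rewrite cmodM !cmodX.
apply: (@le_trans _ _ (r ^+ k.+1)); last by rewrite exprS ler_piMr ?exprn_ile1.
have -> : r ^+ k.+1 = r ^+ (k.+1 - j) * r ^+ j by rewrite -exprD subnK // -ltnS.
rewrite ler_pM ?exprn_ge0 ?cmod_ge0 // lerXn2r ?nnegrE ?cmod_ge0 //.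
Qed.

End RootLocation.

(** * Perturbation of a simple eigenvalue *)

Section CharPoly.
Local Open Scope complex_scope.
Context {R : realType}.
Local Notation C := R[i].

(** p is a fixed polynomial and F h tends to it at rate h, coefficientwise; in a
    bounded degree this is all that continuity of the roots requires. *)
Definition coefs_near (F : R -> {poly C}) (p : {poly C}) : Prop :=
  forall k, bigOh 1 (fun h => (F h)`_k - p`_k).

Lemma coefs_near_bounded F p k : coefs_near F p -> bigOh 0 (fun h => (F h)`_k).
Proof.
move=> Fp; apply: (@bigOh_ext _ _ (fun h => ((F h)`_k - p`_k) + p`_k)) => [h|].
  by rewrite subrK.
by apply: bigOhD; [exact: bigOh_le (Fp k)|exact: bigOh_cst].
Qed.

Lemma coefs_near_cst p : coefs_near (fun=> p) p.
Proof. by move=> k; under [X in bigOh _ X]funext do rewrite subrr; exact: bigOh0. Qed.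

Lemma coefs_nearD F G p q :
  coefs_near F p -> coefs_near G q -> coefs_near (fun h => F h + G h) (p + q).
Proof.
move=> Fp Gq k; apply: bigOh_ext (bigOhD (Fp k) (Gq k)) => h.
by rewrite !coefD; ring.
Qed.

Lemma coefs_nearM F G p q :
  coefs_near F p -> coefs_near G q -> coefs_near (fun h => F h * G h) (p * q).
Proof.
move=> Fp Gq k; apply: (@bigOh_ext _ _ (fun h => \sum_(j < k.+1)
  (((F h)`_j - p`_j) * (G h)`_(k - j) + p`_j * ((G h)`_(k - j) - q`_(k - j))))).
  by move=> h; rewrite !coefM -sumrB; apply: eq_bigr => j _; ring.
apply: bigOh_sum => j; apply: bigOhD.
  exact: bigOhMr (coefs_near_bounded _ Gq).
by apply: bigOhMl => //; exact: bigOh_cst.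
Qed.

Lemma coefs_near_sum (I : Type) (r : seq I) (F : I -> R -> {poly C}) p :
    (forall i, coefs_near (F i) (p i)) ->
  coefs_near (fun h => \sum_(i <- r) F i h) (\sum_(i <- r) p i).
Proof.
move=> Fp; elim: r => [|i r IH].
  by under [X in coefs_near X]funext do rewrite big_nil; rewrite big_nil; exact: coefs_near_cst.
by under [X in coefs_near X]funext do rewrite big_cons; rewrite big_cons; exact: coefs_nearD.
Qed.

Lemma coefs_near_prod (I : Type) (r : seq I) (F : I -> R -> {poly C}) p :
    (forall i, coefs_near (F i) (p i)) ->
  coefs_near (fun h => \prod_(i <- r) F i h) (\prod_(i <- r) p i).
Proof.
move=> Fp; elim: r => [|i r IH].
  by under [X in coefs_near X]funext do rewrite big_nil; rewrite big_nil; exact: coefs_near_cst.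
by under [X in coefs_near X]funext do rewrite big_cons; rewrite big_cons; exact: coefs_nearM.
Qed.

Lemma coefs_near_char_poly n (A : R -> 'M[C]_n) (B : 'M[C]_n) :
    (forall i j, bigOh 1 (fun h => A h i j - B i j)) ->
  coefs_near (fun h => char_poly (A h)) (char_poly B).
Proof.
move=> AB.
have entry i j : coefs_near (fun h => char_poly_mx (A h) i j) (char_poly_mx B i j).
  move=> k; under [X in bigOh _ X]funext do rewrite !mxE !coefB !coefC.
  case: (k == 0)%N; last first.
    by under [X in bigOh _ X]funext do rewrite subrr; exact: bigOh0.
  by apply: bigOh_ext (bigOhN (AB i j)) => h /=; ring.
apply: coefs_near_sum => s.
apply: coefs_nearM; first exact: coefs_near_cst.
by apply: coefs_near_prod => i; exact: entry.
Qed.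

Lemma horner_char_poly n (A : 'M[C]_n) (z : C) :
  (char_poly A).[z] = \det (z%:M - A).
Proof.
rewrite /char_poly -horner_evalE -det_map_mx; congr (\det _).
apply/matrixP => i j; rewrite !mxE /= horner_evalE.
by rewrite hornerD hornerN hornerC hornerMn hornerX.
Qed.

Lemma char_poly_similar (K : fieldType) n (A A' P : 'M[K]_n) : P \in unitmx ->
  A' *m P = P *m A -> char_poly A' = char_poly A.
Proof.
move=> P_unit A'P; pose P' := map_mx (@polyC K) P.
have : \det (char_poly_mx A' *m P') = \det (P' *m char_poly_mx A).
  congr (\det _); rewrite /char_poly_mx mulmxBl mulmxBr -!map_mxM A'P.
  by rewrite scalar_mxC.
rewrite !det_mulmx mulrC; apply: mulfI.
by rewrite /P' det_map_mx polyC_eq0 -unitfE -unitmxE.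
Qed.

Lemma eigenvalue_char_poly_shift n (A : 'M[C]_n) z :
  eigenvalue A z = root (char_poly (A - 1%:M)) (z - 1).
Proof.
rewrite eigenvalue_root_char !rootE !horner_char_poly.
by rewrite raddfB /= opprB addrA subrK.
Qed.

(** Because \adj A *m A = \det A, a vector of fixed mass that A almost kills forces
    the determinant to be as small, without expanding it. *)
Lemma det_of_approx_eigenvector n q (A : R -> 'M[C]_n) (w : R -> 'cV[C]_n) :
    (forall i j, bigOh 0 (fun h => A h i j)) ->
    (forall h, \sum_j w h j 0 = 1) ->
    (forall i, bigOh q (fun h => (A h *m w h) i 0)) ->
  bigOh q (fun h => \det (A h)).
Proof.
move=> A_O w1 Aw_O; apply: (@bigOh_ext _ _ (fun h =>
    \sum_j \sum_i (\adj (A h)) j i * (A h *m w h) i 0)).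
  move=> h; rewrite -[RHS]mulr1 -(w1 h) mulr_sumr; apply: eq_bigr => j _.
  have := congr1 (fun B => (B *m w h) j 0) (mul_adj_mx (A h)).
  by rewrite -mulmxA mul_scalar_mx mxE [in RHS]mxE.
apply: bigOh_sum => j; apply: bigOh_sum => i; apply: bigOhMl => //.
under [X in bigOh _ X]funext do rewrite mxE.
apply: bigOhMl; first exact: bigOh_cst.
apply: bigOh0_det => k l; under [X in bigOh _ X]funext do rewrite !mxE.
exact: A_O.
Qed.

(** The polynomial is taken at L - 1, so that the relevant root is near 0 and the
    condition that 1 be a simple eigenvalue becomes a condition on the linear
    coefficient. *)
Lemma simple_eigenvalue_perturbation n q (L : R -> 'M[C]_n.+1) (L0 : 'M[C]_n.+1)
    (z0 : R -> C) :
    (forall i j, bigOh 1 (fun h => L h i j - L0 i j)) ->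
    (char_poly (L0 - 1%:M))`_1 != 0 ->
    bigOh 1 (fun h => z0 h - 1) ->
    bigOh q.+1 (fun h => \det (L h - (z0 h)%:M)) ->
  exists2 g : R -> C, bigOh q.+1 (fun h => g h - z0 h) &
    exists2 r : R, 0 < r & \forall h \near 0^'+,
      eigenvalue (L h) (g h) /\
      forall z, eigenvalue (L h) z -> cmod (z - 1) < r -> z = g h.
Proof.
move=> LL0 c1_n0 z01 det_O.
pose P h := char_poly (L h - 1%:M); pose p := char_poly (L0 - 1%:M).
have P_mon h : P h \is monic by exact: char_poly_monic.
have P_size h : size (P h) = n.+2 by exact: size_char_poly.
have Pp : coefs_near P p.
  apply: coefs_near_char_poly => i j; apply: bigOh_ext (LL0 i j) => h.
  by rewrite !mxE; ring.
have [a a_root a_near] : exists2 a : R -> C, (forall h, root (P h) (a h)) &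
    forall h, cmod (z0 h - 1 - a h) * cmod (P h)^`().[z0 h - 1]
              <= (n.+2)%:R * cmod (P h).[z0 h - 1].
  have /choice [a aP] : forall h, exists a, root (P h) a /\
      cmod (z0 h - 1 - a) * cmod (P h)^`().[z0 h - 1]
      <= (n.+2)%:R * cmod (P h).[z0 h - 1].
    move=> h; have := @root_near _ (P h) (z0 h - 1) (P_mon h).
    by rewrite P_size => /(_ isT) [a]; exists a.
  by exists a => h; case: (aP h).
pose c := cmod p`_1; have c0 : 0 < c by rewrite lt_def cmod_eq0 c1_n0 cmod_ge0.
have [S S0 S_le] : exists2 S : R, 0 < S &
    \forall h \near 0^'+, \sum_(i < n.+2) i%:R * cmod (P h)`_i <= S.
  have [S S0 S_le] : bigOh 0 (fun h =>
      (\sum_(i < n.+2) i%:R * cmod (P h)`_i)%:C).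
    under [X in bigOh _ X]funext do rewrite rmorph_sum.
    apply: bigOh_sum => i; under [X in bigOh _ X]funext do rewrite rmorphM.
    apply: bigOhMl; first exact: bigOh_cst.
    have [D D0 D_le] := coefs_near_bounded i Pp; exists D => //; near=> h.
    by rewrite cmod_real ger0_norm ?cmod_ge0 //; near: h.
  exists (S + 1); first by rewrite ltr_wpDl.
  near=> h; apply: (le_trans (ler_norm _)); rewrite -cmod_real.
  apply: (@le_trans _ _ S); last by rewrite lerDl.
  by rewrite -[leRHS]mulr1; near: h.
pose r := Num.min 1 (c / 4 / S).
have r0 : 0 < r by rewrite lt_min ltr01 !divr_gt0 ?ltr0n.
(* r is chosen so that both deviations from p`_1, from the points and from h,
   stay below c / 4. *)
have secant_ge : \forall h \near 0^'+, forall x y, cmod x <= r -> cmod y <= r ->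
    c / 2 <= cmod (secant (P h) x y).
  near=> h => x y xr yr.
  have r1 : r <= 1 by rewrite ge_min lexx.
  have := @secant_near_coef1 _ (P h) x y r; rewrite P_size => /(_ isT xr yr r1).
  have Sh : \sum_(i < n.+2) i%:R * cmod (P h)`_i <= S by near: h.
  move=> /le_trans /(_ (ler_wpM2l (ltW r0) Sh)) sec_le.
  have rS : r * S <= c / 4 by rewrite -ler_pdivlMr // ge_min lexx orbT.
  have P1_lt : cmod ((P h)`_1 - p`_1) < c / 4.
    by near: h; apply: bigOh_small; rewrite ?divr_gt0 ?ltr0n //; exact: Pp.
  have : c <= cmod (secant (P h) x y) + cmod (secant (P h) x y - (P h)`_1)
              + cmod ((P h)`_1 - p`_1).
    have -> : c = cmod (secant (P h) x y - (secant (P h) x y - (P h)`_1)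
        - ((P h)`_1 - p`_1)) by congr cmod; ring.
    by rewrite (le_trans (cmodB _ _)) // lerD2r cmodB.
  by lra.
pose g h := 1 + a h.
have g_O : bigOh q.+1 (fun h => g h - z0 h).
  have [D D0 D_le] := det_O.
  exists ((n.+2)%:R * D * (2 / c)); first by rewrite !mulr_ge0 ?invr_ge0 ?cmod_ge0.
  near=> h.
  have -> : cmod (g h - z0 h) = cmod (z0 h - 1 - a h).
    by rewrite cmod_distC /g; congr cmod; ring.
  have z0r : cmod (z0 h - 1) <= r.
    by apply: ltW; near: h; exact: bigOh_small.
  have P'_ge : c / 2 <= cmod (P h)^`().[z0 h - 1].
    rewrite deriv_secant; move: (z0r) (z0r); near: h.
    by apply: filterS secant_ge => h sec zr zr'; exact: sec.
  have : cmod (z0 h - 1 - a h) * (c / 2) <= (n.+2)%:R * (D * h ^+ q.+1).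
    apply: le_trans (ler_wpM2l (cmod_ge0 _) P'_ge) _.
    apply: le_trans (a_near h) _; rewrite ler_wpM2l //.
    rewrite horner_char_poly.
    have -> : (z0 h - 1)%:M - (L h - 1%:M) = - (L h - (z0 h)%:M).
      by rewrite raddfB /= !opprB addrA subrK.
    rewrite -scaleN1r detZ cmodM cmodX cmodN cmod1 expr1n mul1r.
    by near: h.
  rewrite -ler_pdivlMr ?divr_gt0 ?ltr0n // invf_div => /le_trans; apply.
  by rewrite le_eqVlt; apply/orP; left; apply/eqP; ring.
exists g => //; exists r => //; near=> h.
have secP x y : cmod x <= r -> cmod y <= r -> c / 2 <= cmod (secant (P h) x y).
  by move: x y; near: h.
have gr : cmod (g h - 1) < r.
  near: h; apply: bigOh_small => //.
  apply: (@bigOh_ext _ _ (fun h => (g h - z0 h) + (z0 h - 1))).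
    by move=> h; ring.
  by apply: bigOhD => //; exact: bigOh_le g_O.
have g1 : g h - 1 = a h by rewrite /g; ring.
split; first by rewrite eigenvalue_char_poly_shift g1; exact: a_root.
move=> z; rewrite eigenvalue_char_poly_shift => /rootP Pz zr.
have /rootP Pg := a_root h; rewrite -g1 in Pg.
have := horner_secant (P h) (z - 1) (g h - 1).
rewrite Pz Pg subrr => /esym/eqP; rewrite mulf_eq0 => /orP[/eqP zg|/eqP sec0].
  by have -> : z = z - 1 - (g h - 1) + g h by [ring]; rewrite zg add0r.
have := secP _ _ (ltW zr) (ltW gr); rewrite sec0 cmod0.
by rewrite leNgt divr_gt0 ?ltr0n.
Unshelve. all: by end_near. Qed.

End CharPoly.

(** * Formal eigenvector in the moments *)

Section CubicCoefficients.
Context {F : numFieldType}.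
Implicit Types lam sigq sigxy V ux uy Vx Vy : F.

(** phi1 and phi2 as expressions over a field, to be evaluated at complex arguments. *)
Definition cubic_pure lam sigq V : F :=
  V / 6 * (lam ^+ 2 - V ^+ 2) * (1 - 12 * sigq ^+ 2).

Definition cubic_mixed lam sigq sigxy ux uy Vx Vy : F :=
  2^-1 * (- (Vx * Vy ^+ 2)
    + 4 * sigq ^+ 2 * (lam ^+ 2 * (ux - Vx) + 3 * Vx * Vy ^+ 2
                       - uy * Vx * Vy - ux * Vy ^+ 2)
    - 4 * sigq * sigxy * (lam ^+ 2 * (ux - Vx)
                          - (Vx * uy * Vy + ux * Vy ^+ 2))).

End CubicCoefficients.

Section MomentRecursion.
Context {F : numFieldType}.
Variables (lam Vx Vy ux uy sq sxy kx ky : F).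
Implicit Types a b c d : F.

Definition mx4 (rows : seq (seq F)) : 'M[F]_4 := \matrix_(i, j) (nth [::] rows i)`_j.

(** Multiplication by kx X + ky Y on the moments 1, X, Y, XY, with
    X^2 = Y^2 = lam^2. *)
Definition streaming_mx : 'M[F]_4 :=
  mx4 [:: [:: 0; kx; ky; 0];
          [:: kx * lam ^+ 2; 0; 0; ky];
          [:: ky * lam ^+ 2; 0; 0; kx];
          [:: 0; ky * lam ^+ 2; kx * lam ^+ 2; 0]].

(** The relaxation in the moments 1, X, Y, XY of the velocities themselves.  The
    frame velocity u enters only through the last row, with the factor sq - sxy:
    equal parameters make the scheme independent of u. *)
Definition collision_mx : 'M[F]_4 :=
  mx4 [:: [:: 1; 0; 0; 0];
          [:: sq * Vx; 1 - sq; 0; 0];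
          [:: sq * Vy; 0; 1 - sq; 0];
          [:: (sq - sxy) * (ux * Vy + uy * Vx); (sxy - sq) * uy; (sxy - sq) * ux; 1 - sxy]].

(** The inverse of T - 1 on the vectors of zero mass. *)
Definition collision_solve (r : 'cV[F]_4) : 'cV[F]_4 :=
  let qx := - r 1 0 / sq in let qy := - r 2 0 / sq in
  vec4 0 qx qy (- (r 3 0 + (sq - sxy) * (ux * qy + uy * qx)) / sxy).

Local Notation B := streaming_mx.
Local Notation T := collision_mx.

Lemma mx4_mul_vec4 (rows : seq (seq F)) a b c d :
  mx4 rows *m vec4 a b c d =
  vec4 ((nth [::] rows 0)`_0 * a + (nth [::] rows 0)`_1 * b
        + (nth [::] rows 0)`_2 * c + (nth [::] rows 0)`_3 * d)
       ((nth [::] rows 1)`_0 * a + (nth [::] rows 1)`_1 * b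
        + (nth [::] rows 1)`_2 * c + (nth [::] rows 1)`_3 * d)
       ((nth [::] rows 2)`_0 * a + (nth [::] rows 2)`_1 * b
        + (nth [::] rows 2)`_2 * c + (nth [::] rows 2)`_3 * d)
       ((nth [::] rows 3)`_0 * a + (nth [::] rows 3)`_1 * b
        + (nth [::] rows 3)`_2 * c + (nth [::] rows 3)`_3 * d).
Proof.
apply/colP => i; rewrite !mxE !big_ord_recl big_ord0 !mxE /= addr0 !addrA.
by case: i => [[|[|[|[|]]]]].
Qed.

Lemma vec4P (x : 'cV[F]_4) : x = vec4 (x 0 0) (x 1 0) (x 2 0) (x 3 0).
Proof.
apply/colP => i; rewrite mxE.
by case: i => [[|[|[|[|//]]]] Hi] /=; congr (x _ 0); exact: val_inj.
Qed.

Lemma vec4D a b c d a' b' c' d' :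
  vec4 a b c d + vec4 a' b' c' d' = vec4 (a + a') (b + b') (c + c') (d + d') :> 'cV[F]_4.
Proof. by apply/colP => i; rewrite !mxE; case: i => [[|[|[|[|]]]]]. Qed.

Lemma vec4N a b c d : - vec4 a b c d = vec4 (- a) (- b) (- c) (- d) :> 'cV[F]_4.
Proof. by apply/colP => i; rewrite !mxE; case: i => [[|[|[|[|]]]]]. Qed.

Lemma vec4Z k a b c d :
  k *: vec4 a b c d = vec4 (k * a) (k * b) (k * c) (k * d) :> 'cV[F]_4.
Proof. by apply/colP => i; rewrite !mxE; case: i => [[|[|[|[|]]]]]. Qed.

Lemma collision_solve_vec4 a b c d : collision_solve (vec4 a b c d) =
  vec4 0 (- b / sq) (- c / sq)
    (- (d + (sq - sxy) * (ux * (- c / sq) + uy * (- b / sq))) / sxy).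
Proof. by rewrite /collision_solve !mxE. Qed.

Hypotheses (sq_n0 : sq != 0) (sxy_n0 : sxy != 0).

Lemma collision_solveP (r : 'cV[F]_4) : r 0 0 = 0 ->
  T *m collision_solve r = collision_solve r + r.
Proof.
move=> r0; rewrite [r]vec4P r0; move: (r 1 0) (r 2 0) (r 3 0) => r1 r2 r3.
rewrite collision_solve_vec4 mx4_mul_vec4 vec4D /=.
by congr vec4; field; rewrite ?sq_n0 ?sxy_n0.
Qed.

Let sigq := sq^-1 - 2^-1.
Let sigxy := sxy^-1 - 2^-1.

(** The value of the time derivative prescribed by the equation is
    rate1 + h rate2 + h^2 rate3 when the gradient is (kx, ky). *)
Definition rate1 : F := - (Vx * kx + Vy * ky).
Definition rate2 : F :=
  sigq * (lam ^+ 2 - Vx ^+ 2) * kx ^+ 2 - 2 * sigq * Vx * Vy * kx * ky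
  + sigq * (lam ^+ 2 - Vy ^+ 2) * ky ^+ 2.

Definition rate3 : F :=
  - (cubic_pure lam sigq Vx * kx ^+ 3 + cubic_mixed lam sigq sigxy ux uy Vx Vy * (kx * ky ^+ 2)
     + cubic_mixed lam sigq sigxy uy ux Vy Vx * (kx ^+ 2 * ky) + cubic_pure lam sigq Vy * ky ^+ 3).

(** The coefficients of h, h^2 and h^3 in exp (h rate1 + h^2 rate2 + h^3 rate3). *)
Definition factor1 : F := rate1.
Definition factor2 : F := rate2 + rate1 ^+ 2 / 2.
Definition factor3 : F := rate3 + rate1 * rate2 + rate1 ^+ 3 / 6.

(** The terms of the formal eigenvector of exp (- h B) T, order by order:
    T m_n - m_n is the n-th defect. *)
Definition moments0 : 'cV[F]_4 := vec4 1 Vx Vy 0.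
Definition defect1 := B *m (T *m moments0) + factor1 *: moments0.
Definition moments1 := collision_solve defect1.
Definition defect2 :=
  B *m (T *m moments1) - 2^-1 *: (B *m (B *m (T *m moments0)))
  + factor1 *: moments1 + factor2 *: moments0.
Definition moments2 := collision_solve defect2.
Definition defect3 :=
  B *m (T *m moments2) - 2^-1 *: (B *m (B *m (T *m moments1)))
  + 6^-1 *: (B *m (B *m (B *m (T *m moments0))))
  + factor1 *: moments2 + factor2 *: moments1 + factor3 *: moments0.
Definition moments3 := collision_solve defect3.

Lemma collision_moments0 : T *m moments0 = moments0.
Proof.
rewrite mx4_mul_vec4 /=; apply/colP => i; rewrite !mxE.
by case: i => [[|[|[|[|//]]]] Hi] /=; ring.
Qed.

Lemma defect1E : defect1 = vec4 0
  (kx * lam ^+ 2 - (Vx * kx + Vy * ky) * Vx)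
  (ky * lam ^+ 2 - (Vx * kx + Vy * ky) * Vy)
  (lam ^+ 2 * (ky * Vx + kx * Vy)).
Proof.
rewrite /defect1 collision_moments0 /moments0 mx4_mul_vec4 vec4Z vec4D /=.
by congr vec4; rewrite /factor1 /rate1; ring.
Qed.

(** Solvability of the first order: this is where the advection velocity V comes
    from. *)
Lemma defect1_mass : defect1 0 0 = 0.
Proof. by rewrite defect1E mxE. Qed.

(** Solvability of the second order fixes D2. *)
Lemma defect2_mass : defect2 0 0 = 0.
Proof.
rewrite /defect2 collision_solveP ?defect1_mass // -/moments1 collision_moments0.
rewrite /moments1 defect1E collision_solve_vec4 /moments0.
rewrite !(mx4_mul_vec4, vec4Z, vec4N, vec4D) /= mxE /=.
rewrite /factor2 /factor1 /rate2 /rate1 /sigq; field.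
by rewrite ?sq_n0 ?sxy_n0.
Qed.

(** Solvability of the third order fixes D3. *)
Lemma defect3_mass : defect3 0 0 = 0.
Proof.
rewrite /defect3 collision_solveP ?defect2_mass // -/moments2.
rewrite collision_solveP ?defect1_mass // -/moments1 collision_moments0.
rewrite /moments2 /defect2 collision_solveP ?defect1_mass // -/moments1 collision_moments0.
rewrite /moments1 defect1E collision_solve_vec4 /moments0.
rewrite !(mx4_mul_vec4, vec4Z, vec4N, vec4D, collision_solve_vec4) /= mxE /=.
rewrite /factor3 /factor2 /factor1 /rate3 /rate2 /rate1 /cubic_pure /cubic_mixed /sigq /sigxy.
field.
by rewrite ?sq_n0 ?sxy_n0.
Qed.

Lemma collision_moments1 : T *m moments1 = moments1 + defect1.
Proof. by rewrite collision_solveP ?defect1_mass. Qed.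

Lemma collision_moments2 : T *m moments2 = moments2 + defect2.
Proof. by rewrite collision_solveP ?defect2_mass. Qed.

Lemma collision_moments3 : T *m moments3 = moments3 + defect3.
Proof. by rewrite collision_solveP ?defect3_mass. Qed.

Lemma collision_solve_mass r : collision_solve r 0 0 = 0.
Proof. by rewrite mxE. Qed.

End MomentRecursion.

(** * From moments to populations *)

Section Populations.
Context {F : numFieldType}.
Implicit Types (lam kx ky : F) (x : 'cV[F]_4).

Definition sign_x (i : 'I_4) : F := [:: 1; -1; -1; 1]`_i.
Definition sign_y (i : 'I_4) : F := [:: 1; 1; -1; -1]`_i.

(** Populations with given moments 1, X, Y, XY: the characters of the group of
    sign pairs give the inverse of the moment matrix. *)
Definition populations_mx lam : 'M[F]_4 := \matrix_(i, j)
  (4^-1 * [:: 1; sign_x i / lam; sign_y i / lam; sign_x i * sign_y i / lam ^+ 2]`_j).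

Lemma populationsE lam x i : (populations_mx lam *m x) i 0 =
  4^-1 * (x 0 0 + sign_x i / lam * x 1 0 + sign_y i / lam * x 2 0
          + sign_x i * sign_y i / lam ^+ 2 * x 3 0).
Proof.
rewrite [x]vec4P; move: (x 0 0) (x 1 0) (x 2 0) (x 3 0) => a b c d.
by rewrite !mxE !big_ord_recl big_ord0 !mxE /=; ring.
Qed.

Lemma populations_mass lam x : \sum_i (populations_mx lam *m x) i 0 = x 0 0.
Proof.
rewrite (eq_bigr _ (fun i _ => populationsE lam x i)).
rewrite !big_ord_recl big_ord0 /sign_x /sign_y /= -exprVn.
by move: lam^-1 => l; field.
Qed.

Lemma populations_streaming lam kx ky x i : lam != 0 ->
  (populations_mx lam *m (streaming_mx lam kx ky *m x)) i 0 =
  (lam * (kx * sign_x i + ky * sign_y i)) * (populations_mx lam *m x) i 0.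
Proof.
move=> lam_n0; rewrite [x]vec4P; move: (x 0 0) (x 1 0) (x 2 0) (x 3 0) => a b c d.
rewrite mx4_mul_vec4 !populationsE !mxE /=.
by case: i => [[|[|[|[|//]]]] Hi]; rewrite /sign_x /sign_y /=; field.
Qed.

End Populations.

(** * The relaxation matrix of the scheme *)

Section TwistedScheme.
Local Open Scope complex_scope.
Context {R : realType}.
Variables (lam : R) (V u : 'rV[R]_2) (sq sxy : R).
Hypotheses (lam_gt0 : 0 < lam) (sq_neq0 : sq != 0) (sxy_neq0 : sxy != 0).
Let Vx := V 0 0.
Let Vy := V 0 1.
Let ux := u 0 0.
Let uy := u 0 1.
Let s : 'cV[R]_4 := vec4 0 sq sq sxy.
Let e : 'cV[R]_4 := vec4 1 (Vx - ux) (Vy - uy) (ux * uy - ux * Vy - uy * Vx).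
Let M := moment_mx lam u.
Let N : 'M[R]_4 := populations_mx lam.
Let T : 'M[R]_4 := collision_mx Vx Vy ux uy sq sxy.

Let lam_n0 : lam != 0.
Proof. by rewrite gt_eqF. Qed.

Lemma velocityE j :
  velocity lam j = vec2 (lam * sign_x j) (lam * sign_y j).
Proof.
by case: j => [[|[|[|[|//]]]] Hj]; rewrite /velocity /sign_x /sign_y /=
  !(mulr1, mulrN1).
Qed.

(** Passage from the moments of the velocities to those relative to the frame
    velocity u. *)
Definition shift_mx : 'M[R]_4 :=
  mx4 [:: [:: 1; 0; 0; 0]; [:: - ux; 1; 0; 0]; [:: - uy; 0; 1; 0];
          [:: ux * uy; - uy; - ux; 1]].

Lemma moment_populations : M *m N = shift_mx.
Proof.
apply/matrixP => k j; rewrite !mxE !big_ord_recl big_ord0 !mxE /moment_poly !velocityE.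
rewrite !mxE -/ux -/uy.
case: k => [[|[|[|[|//]]]] Hk]; case: j => [[|[|[|[|//]]]] Hj] /=;
  by rewrite /sign_x /sign_y /=; field.
Qed.

Lemma shift_mx_unit : shift_mx \in unitmx.
Proof.
rewrite unitmxE det_trig.
  by rewrite !big_ord_recl big_ord0 !mxE /= !mulr1 unitr1.
apply/is_trig_mxP => i j; rewrite mxE.
by case: i => [[|[|[|[|//]]]] Hi]; case: j => [[|[|[|[|//]]]] Hj].
Qed.

Lemma moment_unit : M \in unitmx.
Proof. by have := shift_mx_unit; rewrite -moment_populations unitmx_mul => /andP[]. Qed.

Lemma populations_unit : N \in unitmx.
Proof. by have := shift_mx_unit; rewrite -moment_populations unitmx_mul => /andP[]. Qed.

Lemma relax_populations (a : 'cV[R]_4) :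
  relax M s e (N *m a) = N *m (T *m a).
Proof.
rewrite /relax; apply: (canLR (mulKmx moment_unit)).
rewrite /density populations_mass !mulmxA moment_populations -mulmxA.
rewrite [a]vec4P; move: (a 0 0) (a 1 0) (a 2 0) (a 3 0) => a0 a1 a2 a3.
rewrite !mx4_mul_vec4; apply/colP => i; rewrite !mxE.
by case: i => [[|[|[|[|//]]]] Hi] /=; ring.
Qed.

Lemma relax_mx_populations : relax_mx M s e *m N = N *m T.
Proof.
apply/matrixP => i j.
have := congr1 (fun c : 'cV_4 => c i 0) (relax_populations (delta_mx j 0)).
by rewrite relax_mxP !mulmxA -!colE !mxE.
Qed.

(** T - 1 is lower triangular with diagonal 0, - sq, - sq, - sxy, so the linear
    coefficient is sq ^+ 2 * sxy. *)
Lemma relax_mx_simple1 : (char_poly (relax_mx M s e - 1%:M))`_1 != 0.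
Proof.
rewrite (@char_poly_similar _ _ (T - 1%:M) _ N) ?populations_unit //; last first.
  by rewrite mulmxBl mulmxBr relax_mx_populations mul1mx mulmx1.
rewrite char_poly_trig; last first.
  apply/is_trig_mxP => i j; rewrite !mxE.
  by case: i => [[|[|[|[|//]]]] Hi]; case: j => [[|[|[|[|//]]]] Hj] //= _; rewrite subrr.
rewrite !big_ord_recl big_ord0 !mxE /= subrr subr0 mulr1.
rewrite coefXM /= -horner_coef0 !hornerE /=.
by rewrite !mulf_neq0 // !oppr_eq0 addrAC subrr add0r oppr_eq0.
Qed.

End TwistedScheme.

(** * Truncated expansions *)

Section PolynomialAsymptotics.
Local Open Scope complex_scope.
Context {R : realType}.
Local Notation C := R[i].

Lemma bigOh0_horner (p : {poly C}) : bigOh 0 (fun h : R => p.[h%:C]).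
Proof.
under [X in bigOh _ X]funext do rewrite horner_coef.
apply: bigOh_sum => k; apply: bigOhMl; first exact: bigOh_cst.
exact: bigOh_le (bigOh_Xid _).
Qed.

Lemma bigOh_horner n (p : {poly C}) :
  (forall k, (k < n)%N -> p`_k = 0) -> bigOh n (fun h : R => p.[h%:C]).
Proof.
move=> p0; have pE : p = drop_poly n p * 'X^n.
  rewrite -[LHS](poly_take_drop n) (_ : take_poly n p = 0) ?add0r //.
  by apply/polyP => k; rewrite coef_take_poly coef0; case: ifP => // /p0.
rewrite pE; under [X in bigOh _ X]funext do rewrite hornerM hornerXn.
by apply: bigOhMl; [exact: bigOh0_horner|exact: bigOh_Xid].
Qed.

Lemma bigOhM_approx n (a b : R -> C) (p q : {poly C}) :
    bigOh n (fun h => a h - p.[h%:C]) -> bigOh 0 b ->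
    bigOh n (fun h => b h - q.[h%:C]) ->
  bigOh n (fun h => a h * b h - (p * q).[h%:C]).
Proof.
move=> ap b_O bq; apply: (@bigOh_ext _ _ (fun h =>
    (a h - p.[h%:C]) * b h + p.[h%:C] * (b h - q.[h%:C]))).
  by move=> h; rewrite hornerM; ring.
apply: bigOhD; first exact: bigOhMr.
by apply: bigOhMl => //; exact: bigOh0_horner.
Qed.

Definition poly3 (a b c d : C) : {poly C} := Poly [:: a; b; c; d].

Lemma poly3E a b c d (x : C) :
  (poly3 a b c d).[x] = a + b * x + c * x ^+ 2 + d * x ^+ 3.
Proof. by rewrite horner_Poly /=; ring. Qed.

Lemma poly3_mul_coef a b c d a' b' c' d' :
  let p := poly3 a b c d * poly3 a' b' c' d' in
  [/\ p`_0 = a * a', p`_1 = a * b' + b * a',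
      p`_2 = a * c' + b * b' + c * a' &
      p`_3 = a * d' + b * c' + c * b' + d * a'].
Proof.
by split; rewrite coefM !big_ord_recr big_ord0 /= !coef_Poly /=; ring.
Qed.

Lemma bigOh_poly3 (a b c : C) :
  bigOh 1 (fun h : R => a * h%:C + b * h%:C ^+ 2 + c * h%:C ^+ 3).
Proof.
apply: (@bigOh_ext _ _ (fun h => (poly3 0 a b c).[h%:C])) => [h|].
  by rewrite poly3E; ring.
by apply: bigOh_horner => -[] // _; rewrite coef_Poly.
Qed.

Lemma exp_taylor3_poly (a b c : C) :
  let l (h : R) := a * h%:C + b * h%:C ^+ 2 + c * h%:C ^+ 3 in
  bigOh 4 (fun h => cexp (l h) -
    (poly3 1 a (b + a ^+ 2 / 2) (c + a * b + a ^+ 3 / 6)).[h%:C]).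
Proof.
move=> l.
have lE h : l h = (poly3 0 a b c).[h%:C] by rewrite poly3E /l; ring.
have l_O : bigOh 1 l by exact: bigOh_poly3.
apply: (@bigOh_ext _ _ (fun h => (cexp (l h) - exp_taylor3 (l h)) +
  (1 + poly3 0 a b c + 2^-1 *: (poly3 0 a b c * poly3 0 a b c)
   + 6^-1 *: (poly3 0 a b c * poly3 0 a b c * poly3 0 a b c)
   - poly3 1 a (b + a ^+ 2 / 2) (c + a * b + a ^+ 3 / 6)).[h%:C])).
  move=> h; rewrite /exp_taylor3 lE !hornerE /=; ring.
apply: bigOhD; first exact: cexp_taylor3.
apply: bigOh_horner => k.
have [c0 c1 c2 c3] := poly3_mul_coef 0 a b c 0 a b c.
have cube j : (poly3 0 a b c * poly3 0 a b c * poly3 0 a b c)`_j =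
  \sum_(i < j.+1) (poly3 0 a b c * poly3 0 a b c)`_i * (poly3 0 a b c)`_(j - i).
  by rewrite coefM.
by case: k => [|[|[|[|//]]]] _; rewrite !(coefB, coefD, coefZ) cube coef1
  !big_ord_recr big_ord0 /= ?(c0, c1, c2, c3) !coef_Poly /=; field.
Qed.

End PolynomialAsymptotics.

(** * Approximate eigenvector of the amplification matrix *)

Section OrderCancellation.
Context {F : numFieldType}.
Implicit Types c b t o : F.

(** In these three identities t_n and o_n are one population of T m_n and of m_n, c is
    the symbol of the advection along its velocity, and b_n are the coefficients of
    the eigenvalue: the hypothesis on t_n, substituted, makes the n-th coefficient
    of exp (- h c) t - z0 o vanish. *)
Lemma order1_cancel c b1 t0 o0 o1 :
  1 * (o1 + (c * t0 + b1 * o0)) + - c * t0 - (1 * o1 + b1 * o0) = 0.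
Proof. by ring. Qed.

Lemma order2_cancel c b1 b2 t0 t1 o0 o1 o2 :
  1 * (o2 + (c * t1 - 2^-1 * (c * (c * t0)) + b1 * o1 + b2 * o0))
  + - c * t1 + c ^+ 2 / 2 * t0 - (1 * o2 + b1 * o1 + b2 * o0) = 0.
Proof. by field. Qed.

Lemma order3_cancel c b1 b2 b3 t0 t1 t2 o0 o1 o2 o3 :
  1 * (o3 + (c * t2 - 2^-1 * (c * (c * t1)) + 6^-1 * (c * (c * (c * t0)))
             + b1 * o2 + b2 * o1 + b3 * o0))
  + - c * t2 + c ^+ 2 / 2 * t1 + - c ^+ 3 / 6 * t0
  - (1 * o3 + b1 * o2 + b2 * o1 + b3 * o0) = 0.
Proof. by field. Qed.

End OrderCancellation.

Section PlaneWaves.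
Local Open Scope complex_scope.
Context {R : realType}.
Local Notation C := R[i].
Variables (lam : R) (V u : 'rV[R]_2) (sq sxy : R) (k : 'rV[R]_2).
Hypotheses (lam_gt0 : 0 < lam) (sq_neq0 : sq != 0) (sxy_neq0 : sxy != 0).
Let Vx := V 0 0.
Let Vy := V 0 1.
Let ux := u 0 0.
Let uy := u 0 1.
Let s : 'cV[R]_4 := vec4 0 sq sq sxy.
Let e : 'cV[R]_4 := vec4 1 (Vx - ux) (Vy - uy) (ux * uy - ux * Vy - uy * Vx).
Let M := moment_mx lam u.
Let L := amplification_mx (velocity lam) M s e k.
Let kx : C := 0 +i* k 0 0.
Let ky : C := 0 +i* k 0 1.
Let Nc : 'M[C]_4 := populations_mx lam%:C.
Let Tc : 'M[C]_4 := collision_mx Vx%:C Vy%:C ux%:C uy%:C sq%:C sxy%:C.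
Let a1 := rate1 Vx%:C Vy%:C kx ky.
Let a2 := rate2 lam%:C Vx%:C Vy%:C sq%:C kx ky.
Let a3 := rate3 lam%:C Vx%:C Vy%:C ux%:C uy%:C sq%:C sxy%:C kx ky.
Let m0 := moments0 Vx%:C Vy%:C.
Let m1 := moments1 lam%:C Vx%:C Vy%:C ux%:C uy%:C sq%:C sxy%:C kx ky.
Let m2 := moments2 lam%:C Vx%:C Vy%:C ux%:C uy%:C sq%:C sxy%:C kx ky.
Let m3 := moments3 lam%:C Vx%:C Vy%:C ux%:C uy%:C sq%:C sxy%:C kx ky.

Let d1 := defect1 lam%:C Vx%:C Vy%:C ux%:C uy%:C sq%:C sxy%:C kx ky.
Let d2 := defect2 lam%:C Vx%:C Vy%:C ux%:C uy%:C sq%:C sxy%:C kx ky.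
Let d3 := defect3 lam%:C Vx%:C Vy%:C ux%:C uy%:C sq%:C sxy%:C kx ky.

Lemma map_populations_mx :
  map_mx (real_complex R) (populations_mx lam) = Nc.
Proof.
apply/matrixP => i j; rewrite !mxE rmorphM /= fmorphV rmorph_nat.
congr (_ * _).
by case: i => [[|[|[|[|//]]]] Hi]; case: j => [[|[|[|[|//]]]] Hj];
  rewrite /sign_x /sign_y /= ?(rmorphM, rmorphXn, fmorphV, rmorphN, rmorph1).
Qed.

Lemma map_collision_mx :
  map_mx (real_complex R) (collision_mx Vx Vy ux uy sq sxy) = Tc.
Proof.
apply/matrixP => i j; rewrite !mxE.
by case: i => [[|[|[|[|//]]]] Hi]; case: j => [[|[|[|[|//]]]] Hj];
  rewrite /= ?(rmorphM, rmorphB, rmorphD, rmorph1, rmorph0).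
Qed.

Lemma relax_mx_populationsC (x : 'cV[C]_4) :
  map_mx (real_complex R) (relax_mx M s e) *m (Nc *m x) = Nc *m (Tc *m x).
Proof.
rewrite -map_populations_mx -map_collision_mx !mulmxA -!map_mxM.
by rewrite relax_mx_populations.
Qed.

Lemma amplification_entry h i j :
  L h i j = cis (- (h * dotv k (velocity lam i))) * (relax_mx M s e i j)%:C.
Proof. by rewrite /L /amplification_mx mul_diag_mx !mxE. Qed.

(* The symbol of v_i . grad. *)
Let c i : C := lam%:C * (kx * sign_x i + ky * sign_y i).

Lemma phase_cexp h i : cis (- (h * dotv k (velocity lam i))) = cexp (- c i * h%:C).
Proof.
rewrite cisE; congr cexp.
rewrite velocityE /dotv !big_ord_recl big_ord0 !mxE /= /c /kx /ky.
have -> : sign_x i = (sign_x i : R)%:C :> C.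
  by case: i => [[|[|[|[|//]]]] Hi]; rewrite /sign_x /= ?rmorphN ?rmorph1.
have -> : sign_y i = (sign_y i : R)%:C :> C.
  by case: i => [[|[|[|[|//]]]] Hi]; rewrite /sign_y /= ?rmorphN ?rmorph1.
rewrite (_ : lift 0 0 = 1); last exact: val_inj.
apply/eqP; rewrite eq_complex /=; apply/andP; split; apply/eqP.
  by ring.
by ring.
Qed.

Lemma amplification_near0 i j : bigOh 1 (fun h =>
  L h i j - map_mx (real_complex R) (relax_mx M s e) i j).
Proof.
apply: (@bigOh_ext _ _ (fun h => (cexp (- c i * h%:C) - 1) * (relax_mx M s e i j)%:C)).
  by move=> h; rewrite amplification_entry phase_cexp [map_mx _ _ _ _]mxE mulrBl mul1r.
apply: bigOhMr; last exact: bigOh_cst.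
apply: bigOh_cexp_sub1; apply: bigOhMl; [exact: bigOh_cst|exact: bigOh_id].
Qed.

Lemma phi1C (sigma W : R) :
  (phi1 lam sigma W)%:C = cubic_pure lam%:C sigma%:C W%:C.
Proof.
by rewrite /phi1 !(rmorph_nat, rmorph1, rmorphXn, fmorphV, rmorphB, rmorphM).
Qed.

Lemma phi2C (sigma sigma' wx wy Wx Wy : R) :
  (phi2 lam sigma sigma' wx wy Wx Wy)%:C =
  cubic_mixed lam%:C sigma%:C sigma'%:C wx%:C wy%:C Wx%:C Wy%:C.
Proof.
by rewrite /phi2 !(rmorph_nat, rmorph1, rmorphXn, fmorphV, rmorphN, rmorphB, rmorphD, rmorphM).
Qed.

Lemma equation_symbolE (tau : C) (dt : R) :
  let sigq := sq^-1 - 2^-1 in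
  let sigxy := sxy^-1 - 2^-1 in
  let D2 := mx2 (sigq * (lam ^+ 2 - Vx ^+ 2)) (- sigq * Vx * Vy)
                (- sigq * Vx * Vy) (sigq * (lam ^+ 2 - Vy ^+ 2)) in
  let D3 := mx2 (phi1 lam sigq Vx) (phi2 lam sigq sigxy ux uy Vx Vy)
                (phi2 lam sigq sigxy uy ux Vy Vx) (phi1 lam sigq Vy) in
  equation_symbol V D2 D3 dt tau (\row_i (0 +i* k 0 i)) =
  tau - (a1 + dt%:C * a2 + dt%:C ^+ 2 * a3).
Proof.
move=> sigq sigxy D2 D3.
have lift1 : lift 0 0 = 1 :> 'I_2 by exact: val_inj.
rewrite /equation_symbol /dotv /ddot !big_ord_recl !big_ord0 !mxE /= lift1.
rewrite -/Vx -/Vy -/kx -/ky !addr0.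
rewrite /a1 /a2 /a3 /rate1 /rate2 /rate3 !phi1C !phi2C.
have sigqE : sigq%:C = sq%:C^-1 - 2^-1 by rewrite rmorphB !fmorphV rmorph_nat.
have sigxyE : sigxy%:C = sxy%:C^-1 - 2^-1 by rewrite rmorphB !fmorphV rmorph_nat.
rewrite -sigqE -sigxyE; clearbody sigq sigxy kx ky Vx Vy ux uy.
rewrite !(rmorphXn, rmorphN, rmorphB, rmorphM) /=.
by ring.
Qed.

Let l (h : R) : C := a1 * h%:C + a2 * h%:C ^+ 2 + a3 * h%:C ^+ 3.
Let w (h : R) : 'cV[C]_4 :=
  Nc *m (m0 + h%:C *: m1 + h%:C ^+ 2 *: m2 + h%:C ^+ 3 *: m3).

Lemma approx_eigenvector_mass h : \sum_j w h j 0 = 1.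
Proof.
have m00 : m0 0 0 = 1 by rewrite mxE.
have m10 : m1 0 0 = 0 by exact: collision_solve_mass.
have m20 : m2 0 0 = 0 by exact: collision_solve_mass.
have m30 : m3 0 0 = 0 by exact: collision_solve_mass.
rewrite /w populations_mass; clearbody m0 m1 m2 m3.
by rewrite !mxE m00 m10 m20 m30 !mulr0 !addr0.
Qed.

(** Entry i of L w is exp (- h c) times entry i of N T m, and N intertwines B with
    multiplication by c.  Hence the four lowest coefficients in h vanish by the
    equations that define the moments m_n. *)
Lemma approx_eigenvector i :
  bigOh 4 (fun h => ((L h - (cexp (l h))%:M) *m w h) i 0).
Proof.
have scq : sq%:C != 0 :> C by rewrite fmorph_eq0.
have scxy : sxy%:C != 0 :> C by rewrite fmorph_eq0.
have lamc : lam%:C != 0 :> C by rewrite fmorph_eq0 gt_eqF.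
pose y (x : 'cV[C]_4) : C := (Nc *m x) i 0.
pose B : 'M[C]_4 := streaming_mx lam%:C kx ky.
have yD x x' : y (x + x') = y x + y x' by rewrite /y mulmxDr mxE.
have yZ b x : y (b *: x) = b * y x by rewrite /y -scalemxAr mxE.
have yN x : y (- x) = - y x by rewrite /y mulmxN mxE.
have yB x : y (B *m x) = c i * y x by exact: populations_streaming.
have y_defect1 x z b : y (B *m x + b *: z) = c i * y x + b * y z.
  by rewrite yD yB yZ.
have y_defect2 x x' z z' b b' :
    y (B *m x' - 2^-1 *: (B *m (B *m x)) + b *: z' + b' *: z) =
    c i * y x' - 2^-1 * (c i * (c i * y x)) + b * y z' + b' * y z.
  by rewrite !(yD, yN, yZ, yB).
have y_defect3 x x' x'' z z' z'' b b' b'' :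
    y (B *m x'' - 2^-1 *: (B *m (B *m x')) + 6^-1 *: (B *m (B *m (B *m x)))
       + b *: z'' + b' *: z' + b'' *: z) =
    c i * y x'' - 2^-1 * (c i * (c i * y x')) + 6^-1 * (c i * (c i * (c i * y x)))
    + b * y z'' + b' * y z' + b'' * y z.
  by rewrite !(yD, yN, yZ, yB).
have y_cubic1 (b : C) x0 x1 x2 x3 :
    y (x0 + b *: x1 + b ^+ 2 *: x2 + b ^+ 3 *: x3) =
    y x0 + b * y x1 + b ^+ 2 * y x2 + b ^+ 3 * y x3.
  by rewrite !yD !yZ.
have y_cubic (A : 'M[C]_4) (b : C) x0 x1 x2 x3 :
    y (A *m (x0 + b *: x1 + b ^+ 2 *: x2 + b ^+ 3 *: x3)) =
    y (A *m x0) + b * y (A *m x1) + b ^+ 2 * y (A *m x2) + b ^+ 3 * y (A *m x3).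
  by rewrite !mulmxDr !yD -!scalemxAr !yZ.
pose t0 := y (Tc *m m0); pose t1 := y (Tc *m m1).
pose t2 := y (Tc *m m2); pose t3 := y (Tc *m m3).
pose o0 := y m0; pose o1 := y m1; pose o2 := y m2; pose o3 := y m3.
have t0E : t0 = o0 by rewrite /t0 /o0 /Tc /m0 collision_moments0.
have t1E : t1 = o1 + (c i * t0 + a1 * o0).
  have TmE : Tc *m m1 = m1 + d1 by exact: collision_moments1.
  rewrite -(y_defect1 (Tc *m m0) m0 a1).
  exact: etrans (congr1 y TmE) (yD _ _).
have t2E : t2 = o2 + (c i * t1 - 2^-1 * (c i * (c i * t0)) + a1 * o1
    + (a2 + a1 ^+ 2 / 2) * o0).
  have TmE : Tc *m m2 = m2 + d2 by exact: collision_moments2.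
  rewrite -(y_defect2 (Tc *m m0) (Tc *m m1) m0 m1 a1 (a2 + a1 ^+ 2 / 2)).
  exact: etrans (congr1 y TmE) (yD _ _).
have t3E : t3 = o3 + (c i * t2 - 2^-1 * (c i * (c i * t1))
    + 6^-1 * (c i * (c i * (c i * t0))) + a1 * o2 + (a2 + a1 ^+ 2 / 2) * o1
    + (a3 + a1 * a2 + a1 ^+ 3 / 6) * o0).
  have TmE : Tc *m m3 = m3 + d3 by exact: collision_moments3.
  rewrite -(y_defect3 (Tc *m m0) (Tc *m m1) (Tc *m m2) m0 m1 m2 a1
    (a2 + a1 ^+ 2 / 2) (a3 + a1 * a2 + a1 ^+ 3 / 6)).
  exact: etrans (congr1 y TmE) (yD _ _).
have wE h : w h i 0 = o0 + h%:C * o1 + h%:C ^+ 2 * o2 + h%:C ^+ 3 * o3.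
  exact: (y_cubic1 h%:C m0 m1 m2 m3).
have LwE h : (L h *m w h) i 0 = cexp (- c i * h%:C) *
    (t0 + h%:C * t1 + h%:C ^+ 2 * t2 + h%:C ^+ 3 * t3).
  have yTE : y (Tc *m (m0 + h%:C *: m1 + h%:C ^+ 2 *: m2 + h%:C ^+ 3 *: m3)) =
      t0 + h%:C * t1 + h%:C ^+ 2 * t2 + h%:C ^+ 3 * t3 by exact: y_cubic.
  rewrite -yTE /y -relax_mx_populationsC [LHS]mxE [in RHS]mxE mulr_sumr.
  apply: eq_bigr => j _; rewrite amplification_entry phase_cexp -mulrA.
  by rewrite [map_mx _ _ _ _]mxE.
(* From here on only the relations between the coefficients matter. *)
have [ci ciE] : exists ci, ci = c i by exists (c i).
rewrite -ciE in t1E t2E t3E LwE.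
clearbody t0 t1 t2 t3 o0 o1 o2 o3 a1 a2 a3.
pose tt := poly3 t0 t1 t2 t3.
pose om := poly3 o0 o1 o2 o3.
pose E := poly3 1 (- ci) (ci ^+ 2 / 2) (- ci ^+ 3 / 6).
pose G := poly3 1 a1 (a2 + a1 ^+ 2 / 2) (a3 + a1 * a2 + a1 ^+ 3 / 6).
apply: (@bigOh_ext _ _ (fun h =>
  (cexp (- ci * h%:C) * tt.[h%:C] - (E * tt).[h%:C])
  - (cexp (l h) * om.[h%:C] - (G * om).[h%:C])
  + (E * tt - G * om).[h%:C])).
  move=> h; rewrite mulmxBl mul_scalar_mx.
  have subE (x x' : 'cV[C]_4) b : (x - b *: x') i 0 = x i 0 - b * x' i 0.
    by rewrite !mxE.
  rewrite subE LwE wE hornerD hornerN [tt.[_]]poly3E [om.[_]]poly3E.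
  by ring.
have E_O : bigOh 4 (fun h => cexp (- ci * h%:C) - E.[h%:C]).
  have := exp_taylor3_poly (- ci) 0 0; apply: bigOh_ext => h /=.
  by congr (_ - _); [congr cexp; ring|rewrite /E !poly3E; ring].
have sub0 (p : {poly C}) : bigOh 4 (fun h : R => p.[h%:C] - p.[h%:C]).
  by under [X in bigOh _ X]funext do rewrite subrr; exact: bigOh0.
apply: bigOhD; first apply: bigOhB.
- by apply: bigOhM_approx => //; exact: bigOh0_horner.
- by apply: bigOhM_approx => //; [exact: exp_taylor3_poly|exact: bigOh0_horner].
apply: bigOh_horner => n.
have [e0 e1 e2 e3] := poly3_mul_coef 1 (- ci) (ci ^+ 2 / 2) (- ci ^+ 3 / 6)
  t0 t1 t2 t3.
have [f0 f1 f2 f3] := poly3_mul_coef 1 a1 (a2 + a1 ^+ 2 / 2)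
  (a3 + a1 * a2 + a1 ^+ 3 / 6) o0 o1 o2 o3.
case: n => [|[|[|[|//]]]] _; rewrite coefB /E /tt /G /om.
- by rewrite e0 f0 t0E subrr.
- rewrite e1 f1 t1E; exact: order1_cancel.
- rewrite e2 f2 t2E; exact: order2_cancel.
- rewrite e3 f3 t3E; exact: order3_cancel.
Qed.

End PlaneWaves.

(** * The equivalent equation *)

Theorem proposition2p4 (R : realType) (lam : R) (V u : 'rV[R]_2) (sq sxy : R)
    (lam_gt0 : 0 < lam) (sq_neq0 : sq != 0) (sxy_neq0 : sxy != 0) :
  let Vx := V 0 0 in let Vy := V 0 1 in
  let ux := u 0 0 in let uy := u 0 1 in
  let sigq := sq^-1 - 2^-1 in
  let sigxy := sxy^-1 - 2^-1 in
  let s := vec4 0 sq sq sxy in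
  let e := vec4 1 (Vx - ux) (Vy - uy) (ux * uy - ux * Vy - uy * Vx) in
  let D2 := mx2 (sigq * (lam ^+ 2 - Vx ^+ 2)) (- sigq * Vx * Vy)
                (- sigq * Vx * Vy) (sigq * (lam ^+ 2 - Vy ^+ 2)) in
  let D3 := mx2 (phi1 lam sigq Vx) (phi2 lam sigq sigxy ux uy Vx Vy)
                (phi2 lam sigq sigxy uy ux Vy Vx) (phi1 lam sigq Vy) in
  approaches_up_to 3 (velocity lam) (moment_mx lam u) s e
    (equation_symbol V D2 D3).
Proof.
move=> Vx Vy ux uy sigq sigxy s e D2 D3 k.
pose L := amplification_mx (velocity lam) (moment_mx lam u) s e k.
pose kx : R[i] := (0 +i* k 0 0)%C; pose ky : R[i] := (0 +i* k 0 1)%C.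
pose a1 := rate1 Vx%:C%C Vy%:C%C kx ky.
pose a2 := rate2 lam%:C%C Vx%:C%C Vy%:C%C sq%:C%C kx ky.
pose a3 := rate3 lam%:C%C Vx%:C%C Vy%:C%C ux%:C%C uy%:C%C sq%:C%C sxy%:C%C kx ky.
pose l (h : R) : R[i] := a1 * h%:C%C + a2 * h%:C%C ^+ 2 + a3 * h%:C%C ^+ 3.
have symbolE tau dt : equation_symbol V D2 D3 dt tau (\row_i (0 +i* k 0 i)%C) =
    tau - (a1 + dt%:C%C * a2 + dt%:C%C ^+ 2 * a3) by exact: equation_symbolE.
have eigenvector_O := approx_eigenvector V u k lam_gt0 sq_neq0 sxy_neq0.
have eigenvector_mass := approx_eigenvector_mass lam V u sq sxy k.
have L_O i j : bigOh 1 (fun h => L h i j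
    - map_mx (real_complex R) (relax_mx (moment_mx lam u) s e) i j).
  exact: amplification_near0.
have l_O : bigOh 1 l by exact: bigOh_poly3.
have det_O : bigOh 4 (fun h => \det (L h - (cexp (l h))%:M)).
  apply: det_of_approx_eigenvector eigenvector_mass eigenvector_O => i j.
  have entryE h : (L h - (cexp (l h))%:M) i j =
      (L h i j - map_mx (real_complex R) (relax_mx (moment_mx lam u) s e) i j)
      + map_mx (real_complex R) (relax_mx (moment_mx lam u) s e) i j
      - ((cexp (l h) - 1) + 1) * (i == j)%:R.
    have subE (A : 'M[R[i]]_4) x : (A - x%:M) i j = A i j - x *+ (i == j).
      by rewrite !mxE.
    by rewrite subE !subrK mulr_natr.
  apply: (bigOh_ext (fun h => esym (entryE h))).
  apply: bigOhB.
    by apply: bigOhD; [exact: bigOh_le (L_O i j)|exact: bigOh_cst].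
  apply: bigOhMr; last exact: bigOh_cst.
  by apply: bigOhD; [exact: bigOh_le (bigOh_cexp_sub1 l_O)|exact: bigOh_cst].
have simple1 : (char_poly
    (map_mx (real_complex R) (relax_mx (moment_mx lam u) s e) - 1%:M))`_1 != 0.
  rewrite -(map_scalar_mx (real_complex R)) -map_mxB -map_char_poly coef_map.
  by rewrite fmorph_eq0 relax_mx_simple1.
have [g g_O [r r0 g_eig]] :=
  simple_eigenvalue_perturbation L_O simple1 (bigOh_cexp_sub1 l_O) det_O.
exists g; first split.
- apply: bigOh_cmod_cvg0.
  apply: (@bigOh_ext _ _ (fun h => (g h - cexp (l h)) + (cexp (l h) - 1))) => [h|].
    by rewrite addrA subrK.
  by apply: bigOhD; [exact: bigOh_le g_O|exact: bigOh_cexp_sub1].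
- by exists r.
have [C C0 clog_le] := bigOh_clog (ltn0Sn 3) l_O g_O.
apply/eqOP; near=> K; near=> h.
have h0 : 0 < h by [].
have hC0 : h%:C%C != 0 :> R[i] by rewrite fmorph_eq0 gt_eqF.
rewrite symbolE !ger0_norm ?cmod_ge0 ?exprn_ge0 ?(ltW h0) //.
have -> : clog (g h) / h%:C%C - (a1 + h%:C%C * a2 + h%:C%C ^+ 2 * a3) =
    (clog (g h) - l h) / h%:C%C by rewrite /l; field.
rewrite cmodM cmodV cmod_real (ger0_norm (ltW h0)) ler_pdivrMr // -mulrA -exprSr.
apply: (@le_trans _ _ (C * h ^+ 4)); first by near: h.
by rewrite ler_wpM2r ?exprn_ge0 ?(ltW h0).
Unshelve. all: by end_near. Qed.
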